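(* Let $\mathcal{C}$ be a category with local products, and let $\mathcal{M}$ be a class of spans in $\mathcal{C}$ (all of whose members $(D,d,c)$ are such that $d$ and $c$ have kernel pairs) that is closed under the kernel pair construction and contains the span part of every local product. Then the following conditions are equivalent: (1) the functor $\mathbf{Grpd}(\mathcal{C},\mathcal{M})\to\mathbf{RG}(\mathcal{C},\mathcal{M})$ is an isomorphism; (2) the functor $\mathbf{Grpd}(\mathcal{C},\mathcal{M})\to\mathbf{RG}(\mathcal{C},\mathcal{M})$ has a section; (3) the functor $\mathbf{Cat}(\mathcal{C},\mathcal{M})\to\mathbf{RG}(\mathcal{C},\mathcal{M})$ is an isomorphism; (4) the functor $\mathbf{Cat}(\mathcal{C},\mathcal{M})\to\mathbf{RG}(\mathcal{C},\mathcal{M})$ has a section; (5) the functor $\mathbf{UMG}(\mathcal{C},\mathcal{M})\to\mathbf{RG}(\mathcal{C},\mathcal{M})$ is an isomorphism; (6) the functor $\mathbf{UMG}(\mathcal{C},\mathcal{M})\to\mathbf{RG}(\mathcal{C},\mathcal{M})$ has a section; (7) the functor $\mathbf{PreGrpd}(\mathcal{C},\mathcal{M})\to\mathbf{Span}(\mathcal{C},\mathcal{M})$ is an isomorphism; (8) the functor $\mathbf{PreGrpd}(\mathcal{C},\mathcal{M})\to\mathbf{Span}(\mathcal{C},\mathcal{M})$ has a section; (9) the functor $\mathbf{MKite}(\mathcal{C},\mathcal{M})\to\mathbf{DiKite}(\mathcal{C},\mathcal{M})$ is an isomorphism; (10) the functor $\mathbf{MKite}(\mathcal{C},\mathcal{M})\to\mathbf{DiKite}(\mathcal{C},\mathcal{M})$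 has a section; (11) for all morphisms $p_1\colon E\to A$, $e_1\colon A\to E$, $p_2\colon E\to C$, $e_2\colon C\to E$, $\alpha\colon A\to D$, $\beta\colon E\to D$, $\gamma\colon C\to D$, $d\colon D\to D_0$, $c\colon D\to D_1$ in $\mathcal{C}$ such that the pair $(p_1,p_2)$ is jointly monic, the spans $(D,d,c)$ and $(E,p_1,p_2)$ belong to $\mathcal{M}$, and $$p_1e_1=1_A,\quad p_2e_2=1_C,\quad (e_1p_1)(e_2p_2)=(e_2p_2)(e_1p_1),$$ $$\alpha(p_1e_2p_2)=\beta=\gamma(p_2e_1p_1),\quad d\alpha p_1=d\alpha(p_1e_2p_2),\quad c\gamma p_2=c\gamma(p_2e_1p_1),$$ there exists a unique morphism $m\colon E\to D$ such that $me_1=\alpha$, $me_2=\gamma$, $dm=d\gamma p_2$, $cm=c\alpha p_1$.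
   Context: **Local products.** A category $\mathcal{C}$ has local products if for all $f\colon A\to B$, $r\colon B\to A$, $g\colon C\to B$, $s\colon B\to C$ with $fr=1_B=gs$, the pullback of $g$ along $f$ exists; it comes with a chosen (canonical) pullback $(A\times_BC,\pi_1,\pi_2)$ (so $f\pi_1=g\pi_2$) and the induced morphisms $e_1=\langle 1_A,sf\rangle\colon A\to A\times_BC$, $e_2=\langle rg,1_C\rangle\colon C\to A\times_BC$. The diagram consisting of such a pullback with $\pi_1,\pi_2,e_1,e_2$ is called a local product, and $(A\times_BC,\pi_1,\pi_2)$ is its span part. **Spans.** A span $(D,d,c)$ is a pair $d\colon D\to D_0$, $c\colon D\to D_1$; only spans for which the kernel pairs of $d$ and $c$ exist are considered. A morphism of spans $(D,d,c)\to(D',d',c')$ is a triple $h_D\colon D\to D'$, $h_0\colon D_0\to D_0'$, $h_1\colon D_1\to D_1'$ with $d'h_D=h_0d$, $c'h_D=h_1c$. $\mathbf{Span}(\mathcal{C},\mathcal{M})$ is the full subcategory of spans in $\mathcal{M}$. **Kernel pair construction.** For a span $(D,d,c)$ with kernel pairs $(D(d),d_1,d_2)$ of $d$ and $(D(c),c_1,c_2)$ of $c$, let $D(d,c)$ be the pullback of $c_1$ along $d_2$ (a local product, both being split by diagonals). Thus morphisms $Z\to D(d,c)$ correspond to triples $\langle x,y,z\rangle$ of morphisms $Z\to D$ with $dx=dy$ and $cy=cz$. Put $\mathrm{dom}\langle x,y,z\rangle=x$, $\mathrm{cod}\langle x,y,z\rangle=z$, defining $\mathrm{dom},\mathrm{cod}\colon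 D(d,c)\to D$. The class $\mathcal{M}$ is closed under the kernel pair construction if $(D,d,c)\in\mathcal{M}$ implies $(D(d,c),\mathrm{dom},\mathrm{cod})\in\mathcal{M}$ (the object $D(d,c)$ being determined up to isomorphism). **Reflexive graphs etc.** $\mathbf{RG}(\mathcal{C})$: objects $(C_1,C_0,d,e,c)$ with $d,c\colon C_1\to C_0$, $e\colon C_0\to C_1$, $de=1_{C_0}=ce$; morphisms $(f_1,f_0)$ with $d'f_1=f_0d$, $c'f_1=f_0c$, $f_1e=e'f_0$. Let $(C_2,\pi_1,\pi_2)$ be the chosen pullback with $d\pi_1=c\pi_2$, $e_1=\langle 1_{C_1},ed\rangle$, $e_2=\langle ec,1_{C_1}\rangle$. $\mathbf{UMG}(\mathcal{C})$ (unital multiplicative graphs): reflexive graphs with $m\colon C_2\to C_1$ such that $dm=d\pi_2$, $cm=c\pi_1$, $me_1=1_{C_1}=me_2$; morphisms are morphisms of reflexive graphs with $f_1m=m'(f_1\times_{f_0}f_1)$. $\mathbf{Cat}(\mathcal{C})$ (internal categories): unital multiplicative graphs with $m$ associative, i.e. $m\langle m\langle x,y\rangle,z\rangle=m\langle x,m\langle y,z\rangle\rangle$ for all $x,y,z\colon Z\to C_1$ with $dx=cy$, $dy=cz$; morphisms as in $\mathbf{UMG}(\mathcal{C})$. $\mathbf{Grpd}(\mathcal{C})$ (internal groupoids): internal categories with inverses, i.e. there is $i\colon C_1\to C_1$ with $di=c$, $ci=d$, $m\langle 1_{C_1},i\rangle=ec$, $m\langle i,1_{C_1}\rangle=ed$;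 same morphisms. For $\mathbf{X}\in\{\mathbf{RG},\mathbf{UMG},\mathbf{Cat},\mathbf{Grpd}\}$, $\mathbf{X}(\mathcal{C},\mathcal{M})$ is the full subcategory of $\mathbf{X}(\mathcal{C})$ of those objects whose span part $(C_1,d,c)$ is in $\mathcal{M}$. **Pregroupoids.** A pregroupoid structure on a span $(D,d,c)$ is $p\colon D(d,c)\to D$ with $p\langle x,y,y\rangle=x$ (whenever $dx=dy$), $p\langle y,y,z\rangle=z$ (whenever $cy=cz$), $dp=d\,\mathrm{cod}$ and $cp=c\,\mathrm{dom}$. $\mathbf{PreGrpd}(\mathcal{C},\mathcal{M})$: spans in $\mathcal{M}$ with a pregroupoid structure; morphisms are span morphisms compatible with the structures. **Directed kites.** A directed kite consists of $f\colon A\to B$, $r\colon B\to A$, $g\colon C\to B$, $s\colon B\to C$, $\alpha\colon A\to D$, $\beta\colon B\to D$, $\gamma\colon C\to D$ with $fr=1_B=gs$, $\alpha r=\beta=\gamma s$, together with a span $(D,d,c)$ with $d\alpha=d\beta f$, $c\beta g=c\gamma$. $\mathbf{DiKite}(\mathcal{C},\mathcal{M})$: directed kites with $(D,d,c)\in\mathcal{M}$; morphisms are natural transformations of such diagrams (components $h_A,h_B,h_C,h_D,h_0,h_1$). A multiplication on a directed kite is $m\colon A\times_BC\to D$ with $dm=d\gamma\pi_2$, $cm=c\alpha\pi_1$, $me_1=\alpha$, $me_2=\gamma$. $\mathbf{MKite}(\mathcal{C},\mathcal{M})$: directed kites with direction in $\mathcal{M}$ equipped with a multiplication; morphisms are those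 of directed kites with $h_Dm=m'(h_A\times_{h_B}h_C)$. All functors in the statement are the evident forgetful ones; ''isomorphism'' means isomorphism of categories; a section of $F$ is a functor $S$ with $FS=\mathrm{Id}$. *)

(* Defs.v *)
(* Proof irrelevance makes objects and morphisms of categories of structured
   objects equal as soon as their components are. *)
From mathcomp Require Import all_boot.
From Stdlib Require Import ProofIrrelevance.

Set Implicit Arguments.
Unset Strict Implicit.
Unset Printing Implicit Defensive.

Declare Scope cat_scope.
Delimit Scope cat_scope with cat.
Local Open Scope cat_scope.

(** * Categories and functors *)

Record Category := MkCategory {
  ob :> Type;
  hom : ob -> ob -> Type;
  idm : forall A, hom A A;
  comp : forall A B C, hom B C -> hom A B -> hom A C;
  comp_id_l : forall A B (f : hom A B), comp (idm B) f = f;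
  comp_id_r : forall A B (f : hom A B), comp f (idm A) = f;
  comp_assoc : forall A B C D (h : hom C D) (g : hom B C) (f : hom A B),
    comp h (comp g f) = comp (comp h g) f }.

Arguments hom {_} _ _.
Arguments idm {_} A.
Arguments comp {_ _ _ _} _ _.

Notation "g ∘ f" := (comp g f) (at level 40, left associativity) : cat_scope.
Notation "1_ A" := (idm A) (at level 2, A at level 2, format "1_ A") : cat_scope.

Record Functor (C D : Category) := MkFunctor {
  fob :> C -> D;
  fmap : forall A B : C, hom A B -> hom (fob A) (fob B);
  fmap_id : forall A, fmap 1_A = 1_(fob A);
  fmap_comp : forall A B E (g : hom B E) (f : hom A B),
    fmap (g ∘ f) = fmap g ∘ fmap f }.

Arguments fmap {_ _} _ {_ _} _.

Definition idF (C : Category) : Functor C C :=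
  @MkFunctor C C (fun A => A) (fun _ _ f => f)
    (fun _ => erefl) (fun _ _ _ _ _ => erefl).

Lemma compF_id (C D E : Category) (G : Functor D E) (F : Functor C D) (A : C) :
  fmap G (fmap F 1_A) = 1_(G (F A)).
Proof. by rewrite !fmap_id. Qed.

Lemma compF_comp (C D E : Category) (G : Functor D E) (F : Functor C D)
    (A B X : C) (g : hom B X) (f : hom A B) :
  fmap G (fmap F (g ∘ f)) = fmap G (fmap F g) ∘ fmap G (fmap F f).
Proof. by rewrite !fmap_comp. Qed.

Definition compF (C D E : Category) (G : Functor D E) (F : Functor C D) :
    Functor C E :=
  @MkFunctor C E (fun A => G (F A)) (fun _ _ f => fmap G (fmap F f))
    (compF_id G F) (compF_comp G F).

(* Equality of functors is strict (Leibniz) equality, so this is isomorphism and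
   not equivalence of categories. *)
Definition is_isomorphism (C D : Category) (F : Functor C D) : Prop :=
  exists G : Functor D C, compF F G = idF D /\ compF G F = idF C.

Definition has_section (C D : Category) (F : Functor C D) : Prop :=
  exists S : Functor D C, compF F S = idF D.

(** * Full subcategories and categories of structured objects *)

Definition FullSub (C : Category) (P : C -> Prop) : Category :=
  @MkCategory {X : C | P X} (fun X Y => hom (sval X) (sval Y))
    (fun X => 1_(sval X)) (fun _ _ _ g f => g ∘ f)
    (fun _ _ => @comp_id_l C _ _) (fun _ _ => @comp_id_r C _ _)
    (fun _ _ _ _ => @comp_assoc C _ _ _ _).

Definition full_incl (C : Category) (P : C -> Prop) : Functor (FullSub P) C :=
  @MkFunctor (FullSub P) C (fun X => sval X) (fun _ _ f => f)
    (fun _ => erefl) (fun _ _ _ _ _ => erefl).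

Definition full_restrict (C D : Category) (F : Functor C D) (P : D -> Prop) :
    Functor (FullSub (fun X : C => P (F X))) (FullSub P) :=
  @MkFunctor (FullSub (fun X : C => P (F X))) (FullSub P)
    (fun X => exist P (F (sval X)) (svalP X)) (fun _ _ f => fmap F f)
    (fun X => fmap_id F (sval X)) (fun _ _ _ g f => fmap_comp F g f).

Record StructureOn (B : Category) := MkStructureOn {
  str : B -> Type;
  str_hom : forall X Y, str X -> str Y -> hom X Y -> Prop;
  str_id : forall X (a : str X), str_hom a a 1_X;
  str_comp : forall X Y Z (a : str X) (b : str Y) (c : str Z)
    (g : hom Y Z) (f : hom X Y),
    str_hom b c g -> str_hom a b f -> str_hom a c (g ∘ f) }.

Lemma sub_eq (T : Type) (P : T -> Prop) (u v : {x : T | P x}) :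
  sval u = sval v -> u = v.
Proof. by case: u v => [u pu] [v pv]; apply: subset_eq_compat. Qed.

Section Structured.
Context (B : Category) (S : StructureOn B).

Definition st_ob := {X : B & str S X}.
Definition st_hom (X Y : st_ob) :=
  {f : hom (projT1 X) (projT1 Y) | str_hom (projT2 X) (projT2 Y) f}.
Definition st_id (X : st_ob) : st_hom X X :=
  exist _ 1_(projT1 X) (str_id (projT2 X)).
Definition st_comp (X Y Z : st_ob) (g : st_hom Y Z) (f : st_hom X Y) :
    st_hom X Z :=
  exist _ (sval g ∘ sval f) (str_comp (svalP g) (svalP f)).

Lemma st_id_l X Y (f : st_hom X Y) : st_comp (st_id Y) f = f.
Proof. exact/sub_eq/comp_id_l. Qed.
Lemma st_id_r X Y (f : st_hom X Y) : st_comp f (st_id X) = f.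
Proof. exact/sub_eq/comp_id_r. Qed.
Lemma st_assoc X Y Z W (h : st_hom Z W) (g : st_hom Y Z) (f : st_hom X Y) :
  st_comp h (st_comp g f) = st_comp (st_comp h g) f.
Proof. exact/sub_eq/comp_assoc. Qed.

Definition Structured : Category := MkCategory st_id_l st_id_r st_assoc.

Definition forget : Functor Structured B :=
  @MkFunctor Structured B (fun X => projT1 X) (fun _ _ f => sval f)
    (fun _ => erefl) (fun _ _ _ _ _ => erefl).

End Structured.

(** * Pullbacks and local products *)

Record Pullback (K : Category) (A B C : K) (f : hom A B) (g : hom C B) :=
  MkPullback {
    pb_ob :> K;
    pb1 : hom pb_ob A;
    pb2 : hom pb_ob C;
    pb_comm : f ∘ pb1 = g ∘ pb2;
    pair : forall Z (x : hom Z A) (y : hom Z C), f ∘ x = g ∘ y -> hom Z pb_ob;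
    pair1 : forall Z (x : hom Z A) (y : hom Z C) (h : f ∘ x = g ∘ y),
      pb1 ∘ pair h = x;
    pair2 : forall Z (x : hom Z A) (y : hom Z C) (h : f ∘ x = g ∘ y),
      pb2 ∘ pair h = y;
    pb_uniq : forall Z (u v : hom Z pb_ob),
      pb1 ∘ u = pb1 ∘ v -> pb2 ∘ u = pb2 ∘ v -> u = v }.

Arguments pair {K A B C f g} _ {Z} x y h.
Arguments pb_uniq {K A B C f g} _ {Z u v}.

Section PullbackMap.
Context (K : Category).
Context (A B C : K) (f : hom A B) (g : hom C B) (P : Pullback f g).
Context (A' B' C' : K) (f' : hom A' B') (g' : hom C' B') (P' : Pullback f' g').
Context (hA : hom A A') (hB : hom B B') (hC : hom C C').
Context (hf : f' ∘ hA = hB ∘ f) (hg : g' ∘ hC = hB ∘ g).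

Lemma pb_map_comm : f' ∘ (hA ∘ pb1 P) = g' ∘ (hC ∘ pb2 P).
Proof. by rewrite !comp_assoc hf hg -!comp_assoc pb_comm. Qed.

(* The morphism $h_A \times_{h_B} h_C$. *)
Definition pb_map : hom P P' := pair P' (hA ∘ pb1 P) (hC ∘ pb2 P) pb_map_comm.

End PullbackMap.

Arguments pb_map {K A B C f g} P {A' B' C' f' g'} P' {hA hB hC} hf hg.

Lemma pb_map_id (K : Category) (A B C : K) (f : hom A B) (g : hom C B)
    (P : Pullback f g) (hf : f ∘ 1_A = 1_B ∘ f) (hg : g ∘ 1_C = 1_B ∘ g) :
  pb_map P P hf hg = 1_P.
Proof.
by apply: (pb_uniq P); rewrite ?pair1 ?pair2 comp_id_l comp_id_r.
Qed.

Lemma pb_map_comp (K : Category)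
    (A B C : K) (f : hom A B) (g : hom C B) (P : Pullback f g)
    (A' B' C' : K) (f' : hom A' B') (g' : hom C' B') (P' : Pullback f' g')
    (A'' B'' C'' : K) (f'' : hom A'' B'') (g'' : hom C'' B'')
    (P'' : Pullback f'' g'')
    (hA : hom A A') (hB : hom B B') (hC : hom C C')
    (hf : f' ∘ hA = hB ∘ f) (hg : g' ∘ hC = hB ∘ g)
    (kA : hom A' A'') (kB : hom B' B'') (kC : hom C' C'')
    (kf : f'' ∘ kA = kB ∘ f') (kg : g'' ∘ kC = kB ∘ g')
    (lf : f'' ∘ (kA ∘ hA) = (kB ∘ hB) ∘ f)
    (lg : g'' ∘ (kC ∘ hC) = (kB ∘ hB) ∘ g) :
  pb_map P P'' lf lg = pb_map P' P'' kf kg ∘ pb_map P P' hf hg.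
Proof.
apply: (pb_uniq P''); rewrite comp_assoc /pb_map !(pair1, pair2).
  by rewrite -[RHS]comp_assoc pair1 comp_assoc.
by rewrite -[RHS]comp_assoc pair2 comp_assoc.
Qed.

Record SplitCospan (K : Category) := MkSplitCospan {
  sc_A : K; sc_B : K; sc_C : K;
  sc_f : hom sc_A sc_B; sc_r : hom sc_B sc_A;
  sc_g : hom sc_C sc_B; sc_s : hom sc_B sc_C;
  sc_fr : sc_f ∘ sc_r = 1_sc_B;
  sc_gs : sc_g ∘ sc_s = 1_sc_B }.

(* The canonical pullback may depend on the chosen sections sc_r and sc_s, not
   only on the cospan. *)
Definition LocalProducts (K : Category) :=
  forall X : SplitCospan K, Pullback (sc_f X) (sc_g X).

Section LocalProduct.
Context (K : Category) (lp : LocalProducts K) (X : SplitCospan K).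

Lemma lp_e1_comm : sc_f X ∘ 1_(sc_A X) = sc_g X ∘ (sc_s X ∘ sc_f X).
Proof. by rewrite comp_assoc sc_gs comp_id_l comp_id_r. Qed.

Lemma lp_e2_comm : sc_f X ∘ (sc_r X ∘ sc_g X) = sc_g X ∘ 1_(sc_C X).
Proof. by rewrite comp_assoc sc_fr comp_id_l comp_id_r. Qed.

Definition lp_e1 : hom (sc_A X) (lp X) :=
  pair (lp X) 1_(sc_A X) (sc_s X ∘ sc_f X) lp_e1_comm.
Definition lp_e2 : hom (sc_C X) (lp X) :=
  pair (lp X) (sc_r X ∘ sc_g X) 1_(sc_C X) lp_e2_comm.

End LocalProduct.

(** * Spans *)

Record SpanOb (K : Category) := MkSpan {
  sp_D : K; sp_D0 : K; sp_D1 : K;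
  sp_d : hom sp_D sp_D0;
  sp_c : hom sp_D sp_D1 }.

Arguments MkSpan {K sp_D sp_D0 sp_D1} sp_d sp_c.

Record SpanHom (K : Category) (S T : SpanOb K) := MkSpanHom {
  sh_D : hom (sp_D S) (sp_D T);
  sh_0 : hom (sp_D0 S) (sp_D0 T);
  sh_1 : hom (sp_D1 S) (sp_D1 T);
  sh_d : sp_d T ∘ sh_D = sh_0 ∘ sp_d S;
  sh_c : sp_c T ∘ sh_D = sh_1 ∘ sp_c S }.

Lemma span_hom_eq (K : Category) (S T : SpanOb K) (u v : SpanHom S T) :
  sh_D u = sh_D v -> sh_0 u = sh_0 v -> sh_1 u = sh_1 v -> u = v.
Proof.
case: u v => [uD u0 u1 ud uc] [vD v0 v1 vd vc] /= eD e0 e1.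
by case: _ / eD in vd vc *; case: _ / e0 in vd *; case: _ / e1 in vc *;
  congr MkSpanHom; apply: proof_irrelevance.
Qed.

Lemma sq_id (K : Category) (A B : K) (f : hom A B) : f ∘ 1_A = 1_B ∘ f.
Proof. by rewrite comp_id_l comp_id_r. Qed.

Lemma sq_comp (K : Category) (A B A' B' A'' B'' : K) (f : hom A B)
    (f' : hom A' B') (f'' : hom A'' B'') (hA : hom A A') (hB : hom B B')
    (kA : hom A' A'') (kB : hom B' B'') :
  f'' ∘ kA = kB ∘ f' -> f' ∘ hA = hB ∘ f ->
  f'' ∘ (kA ∘ hA) = (kB ∘ hB) ∘ f.
Proof. by move=> ek eh; rewrite comp_assoc ek -comp_assoc eh comp_assoc. Qed.

Section SpanCategory.
Context (K : Category).

Definition span_id (S : SpanOb K) : SpanHom S S :=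
  MkSpanHom (sq_id (sp_d S)) (sq_id (sp_c S)).
Definition span_comp (S T U : SpanOb K) (g : SpanHom T U) (f : SpanHom S T) :
    SpanHom S U :=
  MkSpanHom (sq_comp (sh_d g) (sh_d f)) (sq_comp (sh_c g) (sh_c f)).

Lemma span_id_l S T (f : SpanHom S T) : span_comp (span_id T) f = f.
Proof. by apply: span_hom_eq; apply: comp_id_l. Qed.
Lemma span_id_r S T (f : SpanHom S T) : span_comp f (span_id S) = f.
Proof. by apply: span_hom_eq; apply: comp_id_r. Qed.
Lemma span_assoc S T U V (h : SpanHom U V) (g : SpanHom T U)
    (f : SpanHom S T) :
  span_comp h (span_comp g f) = span_comp (span_comp h g) f.
Proof. by apply: span_hom_eq; apply: comp_assoc. Qed.

Definition Span : Category := MkCategory span_id_l span_id_r span_assoc.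

End SpanCategory.

Definition lp_span (K : Category) (lp : LocalProducts K) (X : SplitCospan K) :
    Span K :=
  MkSpan (pb1 (lp X)) (pb2 (lp X)).

Definition SpanM (K : Category) (M : Span K -> Prop) : Category := FullSub M.

(** * The kernel pair construction *)

Record KernelPairs (K : Category) (S : SpanOb K) := MkKernelPairs {
  kp_d : Pullback (sp_d S) (sp_d S);
  kp_c : Pullback (sp_c S) (sp_c S) }.

Section KernelPairConstruction.
Context (K : Category) (lp : LocalProducts K).

Section Object.
Context (S : SpanOb K) (kS : KernelPairs S).

Definition kp_diag_d : hom (sp_D S) (kp_d kS) :=
  pair (kp_d kS) 1_(sp_D S) 1_(sp_D S) erefl.
Definition kp_diag_c : hom (sp_D S) (kp_c kS) :=
  pair (kp_c kS) 1_(sp_D S) 1_(sp_D S) erefl.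

Lemma kp_diag_dK : pb2 (kp_d kS) ∘ kp_diag_d = 1_(sp_D S).
Proof. exact: pair2. Qed.
Lemma kp_diag_cK : pb1 (kp_c kS) ∘ kp_diag_c = 1_(sp_D S).
Proof. exact: pair1. Qed.

(* The pullback of this cospan is $D(d,c)$: a pair of $\langle x,y\rangle$ in
   $D(d)$ and $\langle y,z\rangle$ in $D(c)$. *)
Definition kp_cospan : SplitCospan K := MkSplitCospan kp_diag_dK kp_diag_cK.

Definition kp_ob : K := lp kp_cospan.

Lemma kp_triple_comm Z (x y z : hom Z (sp_D S))
    (xy : sp_d S ∘ x = sp_d S ∘ y) (yz : sp_c S ∘ y = sp_c S ∘ z) :
  sc_f kp_cospan ∘ pair (kp_d kS) x y xy
    = sc_g kp_cospan ∘ pair (kp_c kS) y z yz.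
Proof. by rewrite /= pair1 pair2. Qed.

Definition kp_triple Z (x y z : hom Z (sp_D S))
    (xy : sp_d S ∘ x = sp_d S ∘ y) (yz : sp_c S ∘ y = sp_c S ∘ z) :
    hom Z kp_ob :=
  pair (lp kp_cospan) (pair (kp_d kS) x y xy) (pair (kp_c kS) y z yz)
    (kp_triple_comm xy yz).

Definition kp_dom : hom kp_ob (sp_D S) :=
  pb1 (kp_d kS) ∘ pb1 (lp kp_cospan).
Definition kp_cod : hom kp_ob (sp_D S) :=
  pb2 (kp_c kS) ∘ pb2 (lp kp_cospan).

Definition kp_span : Span K := MkSpan kp_dom kp_cod.

End Object.

Section Map.
Context (S T : SpanOb K) (kS : KernelPairs S) (kT : KernelPairs T).
Context (h : SpanHom S T).

Definition kp_map_d : hom (kp_d kS) (kp_d kT) :=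
  pb_map (kp_d kS) (kp_d kT) (sh_d h) (sh_d h).
Definition kp_map_c : hom (kp_c kS) (kp_c kT) :=
  pb_map (kp_c kS) (kp_c kT) (sh_c h) (sh_c h).

Lemma kp_map_sqd :
  sc_f (kp_cospan kT) ∘ kp_map_d = sh_D h ∘ sc_f (kp_cospan kS).
Proof. exact: pair2. Qed.
Lemma kp_map_sqc :
  sc_g (kp_cospan kT) ∘ kp_map_c = sh_D h ∘ sc_g (kp_cospan kS).
Proof. exact: pair1. Qed.

Definition kp_map : hom (kp_ob kS) (kp_ob kT) :=
  pb_map (lp (kp_cospan kS)) (lp (kp_cospan kT)) kp_map_sqd kp_map_sqc.

End Map.

Lemma kp_map_id (S : SpanOb K) (kS : KernelPairs S) :
  kp_map kS kS (span_id S) = 1_(kp_ob kS).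
Proof.
apply: (pb_uniq (lp (kp_cospan kS))); rewrite /kp_map /pb_map ?pair1 ?pair2.
  by rewrite /kp_map_d pb_map_id comp_id_l comp_id_r.
by rewrite /kp_map_c pb_map_id comp_id_l comp_id_r.
Qed.

Lemma kp_map_comp (S T U : SpanOb K) (kS : KernelPairs S) (kT : KernelPairs T)
    (kU : KernelPairs U) (g : SpanHom T U) (f : SpanHom S T) :
  kp_map kS kU (span_comp g f) = kp_map kT kU g ∘ kp_map kS kT f.
Proof.
apply: (pb_uniq (lp (kp_cospan kU))); rewrite comp_assoc /kp_map /pb_map
  ?pair1 ?pair2 -[RHS]comp_assoc ?pair1 ?pair2 comp_assoc; congr (_ ∘ _).
  exact: pb_map_comp.
exact: pb_map_comp.
Qed.

End KernelPairConstruction.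

Section SpanClass.
Context (K : Category) (lp : LocalProducts K) (M : Span K -> Prop).
Context (kp : forall S : Span K, M S -> KernelPairs S).

(* Only the representative of $D(d,c)$ built from the chosen kernel pairs and the
   canonical local product has to be in M; M need not be closed under
   isomorphism. *)
Definition closed_under_kernel_pairs : Prop :=
  forall (S : Span K) (MS : M S), M (kp_span lp (kp MS)).

Definition contains_local_products : Prop :=
  forall X : SplitCospan K, M (lp_span lp X).

End SpanClass.

(** * Pregroupoids *)

Record PregroupoidStr (K : Category) (lp : LocalProducts K) (S : SpanOb K)
    (kS : KernelPairs S) := MkPregroupoidStr {
  pg_p : hom (kp_ob lp kS) (sp_D S);
  pg_xyy : forall Z (x y : hom Z (sp_D S)) (xy : sp_d S ∘ x = sp_d S ∘ y),
    pg_p ∘ kp_triple lp kS xy erefl = x;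
  pg_yyz : forall Z (y z : hom Z (sp_D S)) (yz : sp_c S ∘ y = sp_c S ∘ z),
    pg_p ∘ kp_triple lp kS erefl yz = z;
  pg_d : sp_d S ∘ pg_p = sp_d S ∘ kp_cod lp kS;
  pg_c : sp_c S ∘ pg_p = sp_c S ∘ kp_dom lp kS }.

Section Pregroupoids.
Context (K : Category) (lp : LocalProducts K) (M : Span K -> Prop).
Context (kp : forall S : Span K, M S -> KernelPairs S).

Definition pregrpd_str (X : SpanM M) : Type := PregroupoidStr lp (kp (svalP X)).

Definition pregrpd_hom (X Y : SpanM M) (p : pregrpd_str X) (q : pregrpd_str Y)
    (h : hom X Y) : Prop :=
  sh_D h ∘ pg_p p = pg_p q ∘ kp_map lp (kp (svalP X)) (kp (svalP Y)) h.

Lemma pregrpd_hom_id X (p : pregrpd_str X) : pregrpd_hom p p 1_X.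
Proof. by rewrite /pregrpd_hom /= kp_map_id comp_id_l comp_id_r. Qed.

Lemma pregrpd_hom_comp X Y Z (p : pregrpd_str X) (q : pregrpd_str Y)
    (r : pregrpd_str Z) (g : hom Y Z) (f : hom X Y) :
  pregrpd_hom q r g -> pregrpd_hom p q f -> pregrpd_hom p r (g ∘ f).
Proof.
rewrite /pregrpd_hom /= => eg ef.
by rewrite (kp_map_comp _ _ (kp (svalP Y))) -comp_assoc ef !comp_assoc eg.
Qed.

Definition pregrpd_structure : StructureOn (SpanM M) :=
  MkStructureOn pregrpd_hom_id pregrpd_hom_comp.

Definition PreGrpdM : Category := Structured pregrpd_structure.
Definition PreGrpd_to_Span : Functor PreGrpdM (SpanM M) :=
  forget pregrpd_structure.

End Pregroupoids.

(** * Reflexive graphs, unital multiplicative graphs, categories, groupoids *)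

Record RGOb (K : Category) := MkRG {
  rg_1 : K; rg_0 : K;
  rg_d : hom rg_1 rg_0;
  rg_e : hom rg_0 rg_1;
  rg_c : hom rg_1 rg_0;
  rg_de : rg_d ∘ rg_e = 1_rg_0;
  rg_ce : rg_c ∘ rg_e = 1_rg_0 }.

Record RGHom (K : Category) (X Y : RGOb K) := MkRGHom {
  rh_1 : hom (rg_1 X) (rg_1 Y);
  rh_0 : hom (rg_0 X) (rg_0 Y);
  rh_d : rg_d Y ∘ rh_1 = rh_0 ∘ rg_d X;
  rh_c : rg_c Y ∘ rh_1 = rh_0 ∘ rg_c X;
  rh_e : rg_e Y ∘ rh_0 = rh_1 ∘ rg_e X }.

Lemma rg_hom_eq (K : Category) (X Y : RGOb K) (u v : RGHom X Y) :
  rh_1 u = rh_1 v -> rh_0 u = rh_0 v -> u = v.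
Proof.
case: u v => [u1 u0 ud uc ue] [v1 v0 vd vc ve] /= e1 e0.
by case: _ / e1 in vd vc ve *; case: _ / e0 in vd vc ve *;
  congr MkRGHom; apply: proof_irrelevance.
Qed.

Section ReflexiveGraphs.
Context (K : Category).

Definition rg_id (X : RGOb K) : RGHom X X :=
  MkRGHom (sq_id (rg_d X)) (sq_id (rg_c X)) (sq_id (rg_e X)).
Definition rg_comp (X Y Z : RGOb K) (g : RGHom Y Z) (f : RGHom X Y) :
    RGHom X Z :=
  MkRGHom (sq_comp (rh_d g) (rh_d f)) (sq_comp (rh_c g) (rh_c f))
    (sq_comp (rh_e g) (rh_e f)).

Lemma rg_id_l X Y (f : RGHom X Y) : rg_comp (rg_id Y) f = f.
Proof. by apply: rg_hom_eq; apply: comp_id_l. Qed.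
Lemma rg_id_r X Y (f : RGHom X Y) : rg_comp f (rg_id X) = f.
Proof. by apply: rg_hom_eq; apply: comp_id_r. Qed.
Lemma rg_assoc X Y Z W (h : RGHom Z W) (g : RGHom Y Z) (f : RGHom X Y) :
  rg_comp h (rg_comp g f) = rg_comp (rg_comp h g) f.
Proof. by apply: rg_hom_eq; apply: comp_assoc. Qed.

Definition RG : Category := MkCategory rg_id_l rg_id_r rg_assoc.

Definition rg_span (X : RG) : Span K := MkSpan (rg_d X) (rg_c X).

Definition rg_cospan (X : RGOb K) : SplitCospan K :=
  MkSplitCospan (rg_de X) (rg_ce X).

End ReflexiveGraphs.

Section Multiplicative.
Context (K : Category) (lp : LocalProducts K).

Definition rg_2 (X : RGOb K) : Pullback (rg_d X) (rg_c X) := lp (rg_cospan X).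

Record UMGStr (X : RGOb K) := MkUMGStr {
  umg_m : hom (rg_2 X) (rg_1 X);
  umg_d : rg_d X ∘ umg_m = rg_d X ∘ pb2 (rg_2 X);
  umg_c : rg_c X ∘ umg_m = rg_c X ∘ pb1 (rg_2 X);
  umg_e1 : umg_m ∘ lp_e1 lp (rg_cospan X) = 1_(rg_1 X);
  umg_e2 : umg_m ∘ lp_e2 lp (rg_cospan X) = 1_(rg_1 X) }.

Definition umg_hom (X Y : RG K) (m : UMGStr X) (m' : UMGStr Y) (f : hom X Y) :
    Prop :=
  rh_1 f ∘ umg_m m = umg_m m' ∘ pb_map (rg_2 X) (rg_2 Y) (rh_d f) (rh_c f).

Lemma umg_hom_id (X : RG K) (m : UMGStr X) : umg_hom m m 1_X.
Proof. by rewrite /umg_hom pb_map_id comp_id_l comp_id_r. Qed.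

Lemma umg_hom_comp (X Y Z : RG K) (m : UMGStr X) (m' : UMGStr Y)
    (m'' : UMGStr Z) (g : hom Y Z) (f : hom X Y) :
  umg_hom m' m'' g -> umg_hom m m' f -> umg_hom m m'' (g ∘ f).
Proof.
rewrite /umg_hom /= => eg ef.
rewrite (pb_map_comp _ (rg_2 Y) _ (rh_d f) (rh_c f) (rh_d g) (rh_c g)).
by rewrite -comp_assoc ef !comp_assoc eg.
Qed.

Definition umg_structure : StructureOn (RG K) :=
  MkStructureOn umg_hom_id umg_hom_comp.

Definition UMG : Category := Structured umg_structure.

Section Laws.
Context (X : RGOb K) (m : UMGStr X).

Definition umg_mul Z (x y : hom Z (rg_1 X)) (xy : rg_d X ∘ x = rg_c X ∘ y) :
    hom Z (rg_1 X) :=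
  umg_m m ∘ pair (rg_2 X) x y xy.

Lemma umg_mul_d Z (x y z : hom Z (rg_1 X)) (xy : rg_d X ∘ x = rg_c X ∘ y)
    (yz : rg_d X ∘ y = rg_c X ∘ z) : rg_d X ∘ umg_mul xy = rg_c X ∘ z.
Proof. by rewrite /umg_mul comp_assoc umg_d -comp_assoc pair2. Qed.

Lemma umg_mul_c Z (x y z : hom Z (rg_1 X)) (xy : rg_d X ∘ x = rg_c X ∘ y)
    (yz : rg_d X ∘ y = rg_c X ∘ z) : rg_d X ∘ x = rg_c X ∘ umg_mul yz.
Proof. by rewrite /umg_mul comp_assoc umg_c -comp_assoc pair1. Qed.

Definition umg_associative : Prop :=
  forall Z (x y z : hom Z (rg_1 X)) (xy : rg_d X ∘ x = rg_c X ∘ y)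
    (yz : rg_d X ∘ y = rg_c X ∘ z),
    umg_mul (umg_mul_d xy yz) = umg_mul (umg_mul_c xy yz).

Lemma umg_inv_r (i : hom (rg_1 X) (rg_1 X)) (ci : rg_c X ∘ i = rg_d X) :
  rg_d X ∘ 1_(rg_1 X) = rg_c X ∘ i.
Proof. by rewrite comp_id_r ci. Qed.

Lemma umg_inv_l (i : hom (rg_1 X) (rg_1 X)) (di : rg_d X ∘ i = rg_c X) :
  rg_d X ∘ i = rg_c X ∘ 1_(rg_1 X).
Proof. by rewrite comp_id_r di. Qed.

Definition umg_has_inverses : Prop :=
  exists (i : hom (rg_1 X) (rg_1 X))
    (di : rg_d X ∘ i = rg_c X) (ci : rg_c X ∘ i = rg_d X),
    umg_mul (umg_inv_r ci) = rg_e X ∘ rg_c X /\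
    umg_mul (umg_inv_l di) = rg_e X ∘ rg_d X.

End Laws.

Definition Cat : Category :=
  FullSub (fun X : UMG => umg_associative (projT2 X)).
Definition Grpd : Category :=
  FullSub (fun X : Cat => umg_has_inverses (projT2 (sval X))).

Definition UMG_forget : Functor UMG (RG K) := forget umg_structure.
Definition Cat_forget : Functor Cat (RG K) :=
  compF UMG_forget (full_incl (fun X : UMG => umg_associative (projT2 X))).
Definition Grpd_forget : Functor Grpd (RG K) :=
  compF Cat_forget
    (full_incl (fun X : Cat => umg_has_inverses (projT2 (sval X)))).

Context (M : Span K -> Prop).

Definition RG_in (X : RG K) : Prop := M (rg_span X).

Definition RGM : Category := FullSub RG_in.
Definition UMGM : Category := FullSub (fun X : UMG => RG_in (UMG_forget X)).
Definition CatM : Category := FullSub (fun X : Cat => RG_in (Cat_forget X)).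
Definition GrpdM : Category := FullSub (fun X : Grpd => RG_in (Grpd_forget X)).

Definition UMG_to_RG : Functor UMGM RGM := full_restrict UMG_forget RG_in.
Definition Cat_to_RG : Functor CatM RGM := full_restrict Cat_forget RG_in.
Definition Grpd_to_RG : Functor GrpdM RGM := full_restrict Grpd_forget RG_in.

End Multiplicative.

(** * Directed kites *)

Record DiKiteOb (K : Category) := MkDiKite {
  dk_cospan : SplitCospan K;
  dk_span : SpanOb K;
  dk_alpha : hom (sc_A dk_cospan) (sp_D dk_span);
  dk_beta : hom (sc_B dk_cospan) (sp_D dk_span);
  dk_gamma : hom (sc_C dk_cospan) (sp_D dk_span);
  dk_alpha_r : dk_alpha ∘ sc_r dk_cospan = dk_beta;
  dk_gamma_s : dk_gamma ∘ sc_s dk_cospan = dk_beta;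
  dk_d : sp_d dk_span ∘ dk_alpha = sp_d dk_span ∘ dk_beta ∘ sc_f dk_cospan;
  dk_c : sp_c dk_span ∘ dk_beta ∘ sc_g dk_cospan = sp_c dk_span ∘ dk_gamma }.

Record DiKiteHom (K : Category) (X Y : DiKiteOb K) := MkDiKiteHom {
  kh_A : hom (sc_A (dk_cospan X)) (sc_A (dk_cospan Y));
  kh_B : hom (sc_B (dk_cospan X)) (sc_B (dk_cospan Y));
  kh_C : hom (sc_C (dk_cospan X)) (sc_C (dk_cospan Y));
  kh_span : SpanHom (dk_span X) (dk_span Y);
  kh_f : sc_f (dk_cospan Y) ∘ kh_A = kh_B ∘ sc_f (dk_cospan X);
  kh_r : sc_r (dk_cospan Y) ∘ kh_B = kh_A ∘ sc_r (dk_cospan X);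
  kh_g : sc_g (dk_cospan Y) ∘ kh_C = kh_B ∘ sc_g (dk_cospan X);
  kh_s : sc_s (dk_cospan Y) ∘ kh_B = kh_C ∘ sc_s (dk_cospan X);
  kh_alpha : dk_alpha Y ∘ kh_A = sh_D kh_span ∘ dk_alpha X;
  kh_beta : dk_beta Y ∘ kh_B = sh_D kh_span ∘ dk_beta X;
  kh_gamma : dk_gamma Y ∘ kh_C = sh_D kh_span ∘ dk_gamma X }.

Lemma dikite_hom_eq (K : Category) (X Y : DiKiteOb K) (u v : DiKiteHom X Y) :
  kh_A u = kh_A v -> kh_B u = kh_B v -> kh_C u = kh_C v ->
  kh_span u = kh_span v -> u = v.
Proof.
case: u v => [uA uB uC uS uf ur ug us ua ub uc]
  [vA vB vC vS vf vr vg vs va vb vc] /= eA eB eC eS.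
case: _ / eA in vf vr va *; case: _ / eB in vf vr vg vs vb *.
case: _ / eC in vg vs vc *; case: _ / eS in va vb vc *.
by congr MkDiKiteHom; apply: proof_irrelevance.
Qed.

Section DirectedKites.
Context (K : Category).

Definition dikite_id (X : DiKiteOb K) : DiKiteHom X X :=
  @MkDiKiteHom K X X _ _ _ (span_id (dk_span X))
    (sq_id (sc_f (dk_cospan X))) (sq_id (sc_r (dk_cospan X)))
    (sq_id (sc_g (dk_cospan X))) (sq_id (sc_s (dk_cospan X)))
    (sq_id (dk_alpha X)) (sq_id (dk_beta X)) (sq_id (dk_gamma X)).

Definition dikite_comp (X Y Z : DiKiteOb K) (g : DiKiteHom Y Z)
    (f : DiKiteHom X Y) : DiKiteHom X Z :=
  @MkDiKiteHom K X Z _ _ _ (span_comp (kh_span g) (kh_span f))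
    (sq_comp (kh_f g) (kh_f f)) (sq_comp (kh_r g) (kh_r f))
    (sq_comp (kh_g g) (kh_g f)) (sq_comp (kh_s g) (kh_s f))
    (sq_comp (kh_alpha g) (kh_alpha f)) (sq_comp (kh_beta g) (kh_beta f))
    (sq_comp (kh_gamma g) (kh_gamma f)).

Lemma dikite_id_l X Y (f : DiKiteHom X Y) : dikite_comp (dikite_id Y) f = f.
Proof. by apply: dikite_hom_eq; rewrite /= ?span_id_l ?comp_id_l. Qed.
Lemma dikite_id_r X Y (f : DiKiteHom X Y) : dikite_comp f (dikite_id X) = f.
Proof. by apply: dikite_hom_eq; rewrite /= ?span_id_r ?comp_id_r. Qed.
Lemma dikite_assoc X Y Z W (h : DiKiteHom Z W) (g : DiKiteHom Y Z)
    (f : DiKiteHom X Y) :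
  dikite_comp h (dikite_comp g f) = dikite_comp (dikite_comp h g) f.
Proof. by apply: dikite_hom_eq; rewrite /= ?span_assoc ?comp_assoc. Qed.

Definition DiKite : Category := MkCategory dikite_id_l dikite_id_r dikite_assoc.

Context (lp : LocalProducts K).

Record MKiteStr (X : DiKiteOb K) := MkMKiteStr {
  mk_m : hom (lp (dk_cospan X)) (sp_D (dk_span X));
  mk_d : sp_d (dk_span X) ∘ mk_m
    = sp_d (dk_span X) ∘ dk_gamma X ∘ pb2 (lp (dk_cospan X));
  mk_c : sp_c (dk_span X) ∘ mk_m
    = sp_c (dk_span X) ∘ dk_alpha X ∘ pb1 (lp (dk_cospan X));
  mk_e1 : mk_m ∘ lp_e1 lp (dk_cospan X) = dk_alpha X;
  mk_e2 : mk_m ∘ lp_e2 lp (dk_cospan X) = dk_gamma X }.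

Definition mkite_hom (X Y : DiKite) (m : MKiteStr X) (m' : MKiteStr Y)
    (h : hom X Y) : Prop :=
  sh_D (kh_span h) ∘ mk_m m
    = mk_m m' ∘ pb_map (lp (dk_cospan X)) (lp (dk_cospan Y)) (kh_f h) (kh_g h).

Lemma mkite_hom_id (X : DiKite) (m : MKiteStr X) : mkite_hom m m 1_X.
Proof. by rewrite /mkite_hom pb_map_id comp_id_l comp_id_r. Qed.

Lemma mkite_hom_comp (X Y Z : DiKite) (m : MKiteStr X) (m' : MKiteStr Y)
    (m'' : MKiteStr Z) (g : hom Y Z) (f : hom X Y) :
  mkite_hom m' m'' g -> mkite_hom m m' f -> mkite_hom m m'' (g ∘ f).
Proof.
rewrite /mkite_hom /= => eg ef.
rewrite (pb_map_comp _ (lp (dk_cospan Y)) _ (kh_f f) (kh_g f)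
  (kh_f g) (kh_g g)).
by rewrite -comp_assoc ef !comp_assoc eg.
Qed.

Definition mkite_structure : StructureOn DiKite :=
  MkStructureOn mkite_hom_id mkite_hom_comp.

Definition MKite : Category := Structured mkite_structure.
Definition MKite_forget : Functor MKite DiKite := forget mkite_structure.

Context (M : Span K -> Prop).

Definition DiKite_in (X : DiKite) : Prop := M (dk_span X).

Definition DiKiteM : Category := FullSub DiKite_in.
Definition MKiteM : Category :=
  FullSub (fun X : MKite => DiKite_in (MKite_forget X)).
Definition MKite_to_DiKite : Functor MKiteM DiKiteM :=
  full_restrict MKite_forget DiKite_in.

End DirectedKites.

Definition jointly_monic (K : Category) (E A C : K) (p1 : hom E A)
    (p2 : hom E C) : Prop :=
  forall Z (u v : hom Z E), p1 ∘ u = p1 ∘ v -> p2 ∘ u = p2 ∘ v -> u = v.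

(* Main.v *)
Require Import Defs.
From mathcomp Require Import all_boot.
From Stdlib Require Import ProofIrrelevance FunctionalExtensionality.
From Stdlib Require Import IndefiniteDescription.

Set Implicit Arguments.
Unset Strict Implicit.
Unset Printing Implicit Defensive.

Local Open Scope cat_scope.

(** Every section yields pregroupoid structures p on the spans in M, natural in
    all span morphisms: for multiplications on kites, D(d,c) is the local product
    of a kite; for multiplications on reflexive graphs, p(x,y,z) is the middle
    component of a composite in the reflexive graph on D(d,c). Natural
    pregroupoids give (11) with m = p(alpha p1, beta, gamma p2). Conversely, by
    (11) every directed kite with direction in M has exactly one multiplication,
    automatically compatible with all morphisms. The structures of (1)-(9) and
    the two sides of the equational laws they have to satisfy are multiplications
    on suitable kites, whence existence, uniqueness, naturality and the laws; the
    inverse of an arrow x is p(e d x, x, e c x). *)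

(** * Functors *)

(* Equality of packed arrows states equality of morphisms whose endpoints are
   only provably equal. *)
Definition arrow (D : Category) (X Y : D) (f : hom X Y) :
    {X : D & {Y : D & hom X Y}} :=
  existT _ X (existT _ Y f).

Lemma arrow_inj (D : Category) (X Y : D) (f g : hom X Y) :
  arrow f = arrow g -> f = g.
Proof. by move=> e; apply: inj_pair2; apply: inj_pair2 e. Qed.

(** Packed equality at identities identifies the object maps; after substituting them, [arrow_inj]
    identifies the morphism maps and proof irrelevance the laws. *)
Lemma functor_ext (C D : Category) (G H : Functor C D) :
  (forall X Y (f : hom X Y), arrow (fmap G f) = arrow (fmap H f)) -> G = H.
Proof.
case: G H => [go gm gi gc] [ho hm hi hc] /= e.
have eo : go = ho.
  apply: functional_extensionality => X.
  exact: (f_equal (@projT1 _ _) (e X X 1_X)).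
case: _ / eo in hm hi hc e *.
have em : gm = hm.
  by do 3 (apply: functional_extensionality_dep => ?); apply/arrow_inj/e.
by case: _ / em in hi hc e *; congr MkFunctor; apply: proof_irrelevance.
Qed.

(** [F (g X) = X] is only a propositional equality, so a morphism of [D] has to be transported
    before it can be lifted along [F]. *)
Definition cast_hom (D : Category) (X X' Y Y' : D) (eX : X' = X) (eY : Y' = Y)
    (f : hom X Y) : hom X' Y' :=
  match esym eX in _ = X0, esym eY in _ = Y0 return hom X0 Y0 with
  | erefl, erefl => f
  end.

Lemma arrow_cast (D : Category) (X X' Y Y' : D) (eX : X' = X) (eY : Y' = Y)
    (f : hom X Y) :
  arrow (cast_hom eX eY f) = arrow f.
Proof. by case: _ / eX f; case: _ / eY. Qed.

Lemma cast_hom_id (D : Category) (X X' : D) (eX : X' = X) :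
  cast_hom eX eX 1_X = 1_X'.
Proof. by case: _ / eX. Qed.

Lemma cast_hom_comp (D : Category) (X X' Y Y' Z Z' : D) (eX : X' = X)
    (eY : Y' = Y) (eZ : Z' = Z) (g : hom Y Z) (f : hom X Y) :
  cast_hom eX eZ (g ∘ f) = cast_hom eY eZ g ∘ cast_hom eX eY f.
Proof. by case: _ / eX f; case: _ / eY g; case: _ / eZ. Qed.

Lemma iso_has_section (C D : Category) (F : Functor C D) :
  is_isomorphism F -> has_section F.
Proof. by case=> G [e _]; exists G. Qed.

(** * Strict isomorphisms from fullness, faithfulness and bijectivity on objects *)

Section IsoCriterion.
Context (C D : Category) (F : Functor C D) (g : D -> C).
Context (lift : forall A B, hom (F A) (F B) -> hom A B).
Hypothesis gK : forall X, F (g X) = X.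
Hypothesis Fg : forall A, g (F A) = A.
Hypothesis liftK : forall A B (u : hom (F A) (F B)), fmap F (lift u) = u.
Hypothesis faithful : forall A B (u v : hom A B), fmap F u = fmap F v -> u = v.

Let gmap (X Y : D) (f : hom X Y) : hom (g X) (g Y) :=
  lift (cast_hom (gK X) (gK Y) f).

Lemma gmap_id X : gmap 1_X = 1_(g X).
Proof. by apply: faithful; rewrite liftK cast_hom_id fmap_id. Qed.

Lemma gmap_comp X Y Z (v : hom Y Z) (u : hom X Y) :
  gmap (v ∘ u) = gmap v ∘ gmap u.
Proof.
by apply: faithful; rewrite fmap_comp !liftK (cast_hom_comp _ (gK Y)).
Qed.

Lemma iso_criterion : is_isomorphism F.
Proof.
exists (MkFunctor gmap_id gmap_comp); split; apply: functor_ext => X Y f /=.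
  by rewrite liftK arrow_cast.
rewrite /gmap; move: (gK _) (gK _).
move: (g (F X)) (Fg X) (g (F Y)) (Fg Y) => X' eX Y' eY.
case: _ / eX f => f; case: _ / eY f => f e e'; congr arrow; apply: faithful.
by rewrite liftK; apply: arrow_inj; rewrite arrow_cast.
Qed.

End IsoCriterion.

(** * Natural families of structures from sections *)

Section SectionCriterion.
Context (C D : Category) (F : Functor C D) (T : D -> Type).
Context (R : forall X Y, T X -> T Y -> hom X Y -> Prop).
Context (a : forall A, T (F A)).
Hypothesis Ra : forall A B (u : hom A B), R (a A) (a B) (fmap F u).

(** The structure carried by [S X] lives over [F (S X)] and is transported along [F (S X) = X];
    compatibility of the family with [f] is that of [fmap S f]. *)
Lemma section_natural_family : has_section F ->
  exists t : forall X, T X, forall X Y (f : hom X Y), R (t X) (t Y) f.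
Proof.
case=> S e; pose eo X : F (S X) = X := f_equal (fun G : Functor D D => G X) e.
exists (fun X => eq_rect _ T (a (S X)) _ (eo X)) => X Y f.
have ef : arrow (fmap F (fmap S f)) = arrow f.
  exact: (f_equal (fun G : Functor D D => arrow (fmap G f)) e).
move: (Ra (fmap S f)) (eo X) (eo Y) ef.
move: (a (S X)) (a (S Y)) (fmap F (fmap S f)).
move: (F (S X)) (F (S Y)) => X' Y' b b' f' Rf' eX eY.
by case: _ / eX f; case: _ / eY => f /= /arrow_inj <-.
Qed.

End SectionCriterion.

(** * Pullbacks and kernel triples *)

Section Reassociation.
Context (K : Category) (A B C Z : K).

Lemma comp_tail (f : hom A B) (g : hom B C) (h : hom A C) (k : hom Z A) :
  g ∘ f = h -> g ∘ (f ∘ k) = h ∘ k.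
Proof. by move=> <-; rewrite comp_assoc. Qed.

Lemma comp_tail2 (B' : K) (f : hom A B) (g : hom B C) (f' : hom A B')
    (g' : hom B' C) (k : hom Z A) :
  g ∘ f = g' ∘ f' -> g ∘ (f ∘ k) = g' ∘ (f' ∘ k).
Proof. by move=> e; rewrite !comp_assoc e. Qed.

End Reassociation.

Section PullbackPairs.
Context (K : Category) (A B C : K) (f : hom A B) (g : hom C B).
Context (P : Pullback f g).

Lemma pair_eq Z (x x' : hom Z A) (y y' : hom Z C) (h : f ∘ x = g ∘ y)
    (h' : f ∘ x' = g ∘ y') :
  x = x' -> y = y' -> pair P x y h = pair P x' y' h'.
Proof. by move=> ex ey; apply: (pb_uniq P); rewrite ?pair1 ?pair2. Qed.

Lemma pair_comp Z W (x : hom Z A) (y : hom Z C) (h : f ∘ x = g ∘ y)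
    (k : hom W Z) (h' : f ∘ (x ∘ k) = g ∘ (y ∘ k)) :
  pair P x y h ∘ k = pair P (x ∘ k) (y ∘ k) h'.
Proof.
by apply: (pb_uniq P); rewrite ?pair1 ?pair2 comp_assoc ?pair1 ?pair2.
Qed.

End PullbackPairs.

Section KernelTriples.
Context (K : Category) (lp : LocalProducts K) (S : SpanOb K).
Context (kS : KernelPairs S).

Definition kp_mid : hom (kp_ob lp kS) (sp_D S) :=
  pb2 (kp_d kS) ∘ pb1 (lp (kp_cospan kS)).

Lemma kp_midE : kp_mid = pb1 (kp_c kS) ∘ pb2 (lp (kp_cospan kS)).
Proof. exact: (pb_comm (lp (kp_cospan kS))). Qed.

Lemma kp_dom_mid : sp_d S ∘ kp_dom lp kS = sp_d S ∘ kp_mid.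
Proof. exact/comp_tail2/pb_comm. Qed.

Lemma kp_mid_cod : sp_c S ∘ kp_mid = sp_c S ∘ kp_cod lp kS.
Proof. by rewrite kp_midE; apply/comp_tail2/pb_comm. Qed.

Lemma kp_uniq Z (u v : hom Z (kp_ob lp kS)) :
  kp_dom lp kS ∘ u = kp_dom lp kS ∘ v -> kp_mid ∘ u = kp_mid ∘ v ->
  kp_cod lp kS ∘ u = kp_cod lp kS ∘ v -> u = v.
Proof.
move=> e1 e2 e3; have e2' := e2; rewrite kp_midE in e2'.
apply: (pb_uniq (lp (kp_cospan kS))).
  by apply: (pb_uniq (kp_d kS)); rewrite !comp_assoc.
by apply: (pb_uniq (kp_c kS)); rewrite !comp_assoc.
Qed.

Section Triple.
Context (Z : K) (x y z : hom Z (sp_D S)).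
Context (xy : sp_d S ∘ x = sp_d S ∘ y) (yz : sp_c S ∘ y = sp_c S ∘ z).

Lemma dom_triple : kp_dom lp kS ∘ kp_triple lp kS xy yz = x.
Proof. by rewrite /kp_dom /kp_triple -comp_assoc !pair1. Qed.

Lemma mid_triple : kp_mid ∘ kp_triple lp kS xy yz = y.
Proof. by rewrite /kp_mid /kp_triple -comp_assoc pair1 pair2. Qed.

Lemma cod_triple : kp_cod lp kS ∘ kp_triple lp kS xy yz = z.
Proof. by rewrite /kp_cod /kp_triple -comp_assoc !pair2. Qed.

End Triple.

Lemma eq_triple Z (t : hom Z (kp_ob lp kS)) (x y z : hom Z (sp_D S))
    (xy : sp_d S ∘ x = sp_d S ∘ y) (yz : sp_c S ∘ y = sp_c S ∘ z) :
  kp_dom lp kS ∘ t = x -> kp_mid ∘ t = y -> kp_cod lp kS ∘ t = z ->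
  t = kp_triple lp kS xy yz.
Proof.
by move=> *; apply: kp_uniq; rewrite ?dom_triple ?mid_triple ?cod_triple.
Qed.

Lemma triple_eq Z (x y z x' y' z' : hom Z (sp_D S))
    (xy : sp_d S ∘ x = sp_d S ∘ y) (yz : sp_c S ∘ y = sp_c S ∘ z)
    (xy' : sp_d S ∘ x' = sp_d S ∘ y') (yz' : sp_c S ∘ y' = sp_c S ∘ z') :
  x = x' -> y = y' -> z = z' -> kp_triple lp kS xy yz = kp_triple lp kS xy' yz'.
Proof.
by move=> *; apply: eq_triple; rewrite ?dom_triple ?mid_triple ?cod_triple.
Qed.

Lemma triple_comp Z W (x y z : hom Z (sp_D S)) (k : hom W Z)
    (xy : sp_d S ∘ x = sp_d S ∘ y) (yz : sp_c S ∘ y = sp_c S ∘ z)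
    (xy' : sp_d S ∘ (x ∘ k) = sp_d S ∘ (y ∘ k))
    (yz' : sp_c S ∘ (y ∘ k) = sp_c S ∘ (z ∘ k)) :
  kp_triple lp kS xy yz ∘ k = kp_triple lp kS xy' yz'.
Proof.
by apply: eq_triple; rewrite comp_assoc ?dom_triple ?mid_triple ?cod_triple.
Qed.

End KernelTriples.

Section KernelMap.
Context (K : Category) (lp : LocalProducts K) (S T : SpanOb K).
Context (kS : KernelPairs S) (kT : KernelPairs T) (h : SpanHom S T).

Lemma kp_map_dom :
  kp_dom lp kT ∘ kp_map lp kS kT h = sh_D h ∘ kp_dom lp kS.
Proof.
rewrite /kp_dom /kp_map /pb_map -comp_assoc pair1 !comp_assoc.
by rewrite /kp_map_d /pb_map pair1.
Qed.

Lemma kp_map_mid :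
  kp_mid lp kT ∘ kp_map lp kS kT h = sh_D h ∘ kp_mid lp kS.
Proof.
rewrite /kp_mid /kp_map /pb_map -comp_assoc pair1 !comp_assoc.
by rewrite /kp_map_d /pb_map pair2.
Qed.

Lemma kp_map_cod :
  kp_cod lp kT ∘ kp_map lp kS kT h = sh_D h ∘ kp_cod lp kS.
Proof.
rewrite /kp_cod /kp_map /pb_map -comp_assoc pair2 !comp_assoc.
by rewrite /kp_map_c /pb_map pair2.
Qed.

End KernelMap.

Section PregroupoidTriples.
Context (K : Category) (lp : LocalProducts K) (S : SpanOb K).
Context (kS : KernelPairs S) (p : PregroupoidStr lp kS).
Context (Z : K) (x y z : hom Z (sp_D S)).
Context (xy : sp_d S ∘ x = sp_d S ∘ y) (yz : sp_c S ∘ y = sp_c S ∘ z).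

(** Stated for a propositional y = z and arbitrary witnesses, so that it applies to triples whose
    components agree only after rewriting. *)
Lemma pg_unit_r : y = z -> pg_p p ∘ kp_triple lp kS xy yz = x.
Proof.
by move=> e; rewrite -[RHS](pg_xyy p xy); congr (_ ∘ _); apply: triple_eq.
Qed.

Lemma pg_unit_l : x = y -> pg_p p ∘ kp_triple lp kS xy yz = z.
Proof.
by move=> e; rewrite -[RHS](pg_yyz p yz); congr (_ ∘ _); apply: triple_eq.
Qed.

Lemma pg_triple_d : sp_d S ∘ (pg_p p ∘ kp_triple lp kS xy yz) = sp_d S ∘ z.
Proof. by rewrite (comp_tail2 _ (pg_d p)) cod_triple. Qed.

Lemma pg_triple_c : sp_c S ∘ (pg_p p ∘ kp_triple lp kS xy yz) = sp_c S ∘ x.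
Proof. by rewrite (comp_tail2 _ (pg_c p)) dom_triple. Qed.

End PregroupoidTriples.

(** * The kite of kernel pairs *)

Section KernelKite.
Context (K : Category) (lp : LocalProducts K).

Section Object.
Context (S : SpanOb K) (kS : KernelPairs S).

Lemma kernel_kite_alpha_r : pb1 (kp_d kS) ∘ kp_diag_d kS = 1_(sp_D S).
Proof. exact: pair1. Qed.

Lemma kernel_kite_gamma_s : pb2 (kp_c kS) ∘ kp_diag_c kS = 1_(sp_D S).
Proof. exact: pair2. Qed.

Lemma kernel_kite_d :
  sp_d S ∘ pb1 (kp_d kS) = sp_d S ∘ 1_(sp_D S) ∘ pb2 (kp_d kS).
Proof. by rewrite comp_id_r pb_comm. Qed.

Lemma kernel_kite_c :
  sp_c S ∘ 1_(sp_D S) ∘ pb1 (kp_c kS) = sp_c S ∘ pb2 (kp_c kS).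
Proof. by rewrite comp_id_r pb_comm. Qed.

(* Its local product is $D(d,c)$, so that a multiplication on it is a
   pregroupoid structure. *)
Definition kernel_kite : DiKiteOb K :=
  @MkDiKite K (kp_cospan kS) S _ _ _ kernel_kite_alpha_r kernel_kite_gamma_s
    kernel_kite_d kernel_kite_c.

(** Since <x,y,y> factors through the first inclusion of the local product, the law p<x,y,y> = x
    becomes [mk_e1]. *)
Lemma triple_e1 Z (x y : hom Z (sp_D S)) (xy : sp_d S ∘ x = sp_d S ∘ y) :
  kp_triple lp kS xy erefl = lp_e1 lp (kp_cospan kS) ∘ pair (kp_d kS) x y xy.
Proof.
apply: (pb_uniq (lp (kp_cospan kS))); rewrite comp_assoc.
  by rewrite !pair1 comp_id_l.
rewrite !pair2 -comp_assoc /= pair2.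
by apply: (pb_uniq (kp_c kS)); rewrite comp_assoc ?pair1 ?pair2 comp_id_l.
Qed.

Lemma triple_e2 Z (y z : hom Z (sp_D S)) (yz : sp_c S ∘ y = sp_c S ∘ z) :
  kp_triple lp kS erefl yz = lp_e2 lp (kp_cospan kS) ∘ pair (kp_c kS) y z yz.
Proof.
apply: (pb_uniq (lp (kp_cospan kS))); rewrite comp_assoc.
  rewrite !pair1 -comp_assoc /= pair1.
  by apply: (pb_uniq (kp_d kS)); rewrite comp_assoc ?pair1 ?pair2 comp_id_l.
by rewrite !pair2 comp_id_l.
Qed.

Section FromKite.
Context (m : MKiteStr lp kernel_kite).

Lemma kite_pg_xyy Z (x y : hom Z (sp_D S)) (xy : sp_d S ∘ x = sp_d S ∘ y) :
  mk_m m ∘ kp_triple lp kS xy erefl = x.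
Proof. by rewrite triple_e1 comp_assoc (mk_e1 m) pair1. Qed.

Lemma kite_pg_yyz Z (y z : hom Z (sp_D S)) (yz : sp_c S ∘ y = sp_c S ∘ z) :
  mk_m m ∘ kp_triple lp kS erefl yz = z.
Proof. by rewrite triple_e2 comp_assoc (mk_e2 m) pair2. Qed.

Lemma kite_pg_d : sp_d S ∘ mk_m m = sp_d S ∘ kp_cod lp kS.
Proof. by rewrite (mk_d m) -comp_assoc. Qed.

Lemma kite_pg_c : sp_c S ∘ mk_m m = sp_c S ∘ kp_dom lp kS.
Proof. by rewrite (mk_c m) -comp_assoc. Qed.

Definition kite_pregroupoid : PregroupoidStr lp kS :=
  MkPregroupoidStr kite_pg_xyy kite_pg_yyz kite_pg_d kite_pg_c.

End FromKite.

Section ToKite.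
Context (p : PregroupoidStr lp kS).

Lemma pg_kite_d :
  sp_d S ∘ pg_p p = sp_d S ∘ pb2 (kp_c kS) ∘ pb2 (lp (kp_cospan kS)).
Proof. by rewrite (pg_d p) -comp_assoc. Qed.

Lemma pg_kite_c :
  sp_c S ∘ pg_p p = sp_c S ∘ pb1 (kp_d kS) ∘ pb1 (lp (kp_cospan kS)).
Proof. by rewrite (pg_c p) -comp_assoc. Qed.

(** The unit law is applied to the universal pair of the kernel pair of d, whose induced morphism is
    the identity. *)
Lemma pg_kite_e1 : pg_p p ∘ lp_e1 lp (kp_cospan kS) = pb1 (kp_d kS).
Proof.
rewrite -[RHS](pg_xyy p (pb_comm (kp_d kS))) triple_e1 comp_assoc.
have -> : pair (kp_d kS) _ _ (pb_comm (kp_d kS)) = 1_(kp_d kS).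
  by apply: (pb_uniq (kp_d kS)); rewrite ?pair1 ?pair2 comp_id_r.
by rewrite comp_id_r.
Qed.

Lemma pg_kite_e2 : pg_p p ∘ lp_e2 lp (kp_cospan kS) = pb2 (kp_c kS).
Proof.
rewrite -[RHS](pg_yyz p (pb_comm (kp_c kS))) triple_e2 comp_assoc.
have -> : pair (kp_c kS) _ _ (pb_comm (kp_c kS)) = 1_(kp_c kS).
  by apply: (pb_uniq (kp_c kS)); rewrite ?pair1 ?pair2 comp_id_r.
by rewrite comp_id_r.
Qed.

Definition pregroupoid_kite : MKiteStr lp kernel_kite :=
  @MkMKiteStr K lp kernel_kite (pg_p p) pg_kite_d pg_kite_c
    pg_kite_e1 pg_kite_e2.

End ToKite.

End Object.

Section Map.
Context (S T : SpanOb K) (kS : KernelPairs S) (kT : KernelPairs T).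
Context (h : SpanHom S T).

Lemma kernel_kite_hom_r :
  kp_diag_d kT ∘ sh_D h = kp_map_d kS kT h ∘ kp_diag_d kS.
Proof.
by apply: (pb_uniq (kp_d kT)); rewrite !comp_assoc ?pair1 ?pair2 comp_id_l
  -comp_assoc ?pair1 ?pair2 comp_id_r.
Qed.

Lemma kernel_kite_hom_s :
  kp_diag_c kT ∘ sh_D h = kp_map_c kS kT h ∘ kp_diag_c kS.
Proof.
by apply: (pb_uniq (kp_c kT)); rewrite !comp_assoc ?pair1 ?pair2 comp_id_l
  -comp_assoc ?pair1 ?pair2 comp_id_r.
Qed.

Definition kernel_kite_hom : DiKiteHom (kernel_kite kS) (kernel_kite kT) :=
  @MkDiKiteHom K (kernel_kite kS) (kernel_kite kT) _ _ _ h
    (kp_map_sqd kS kT h) kernel_kite_hom_r (kp_map_sqc kS kT h)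
    kernel_kite_hom_s (pair1 _ _) (esym (sq_id (sh_D h))) (pair2 _ _).

End Map.
End KernelKite.

(** * Multiplication of generalized elements *)

Section UMGMul.
Context (K : Category) (lp : LocalProducts K) (X : RGOb K) (m : UMGStr lp X).

Lemma umg_mul_eq Z (x y x' y' : hom Z (rg_1 X)) (xy : rg_d X ∘ x = rg_c X ∘ y)
    (xy' : rg_d X ∘ x' = rg_c X ∘ y') :
  x = x' -> y = y' -> umg_mul m xy = umg_mul m xy'.
Proof. by move=> ex ey; congr (_ ∘ _); apply: pair_eq. Qed.

Lemma umg_mul_comp Z W (x y : hom Z (rg_1 X)) (k : hom W Z)
    (xy : rg_d X ∘ x = rg_c X ∘ y)
    (xy' : rg_d X ∘ (x ∘ k) = rg_c X ∘ (y ∘ k)) :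
  umg_mul m xy ∘ k = umg_mul m xy'.
Proof. by rewrite /umg_mul -comp_assoc (pair_comp _ _ xy'). Qed.

Lemma umg_mul_unit_r Z (x y : hom Z (rg_1 X)) (xy : rg_d X ∘ x = rg_c X ∘ y) :
  y = rg_e X ∘ (rg_d X ∘ x) -> umg_mul m xy = x.
Proof.
move=> ey; rewrite -[RHS]comp_id_l -(umg_e1 m) -comp_assoc; congr (_ ∘ _).
by apply: (pb_uniq (rg_2 lp X)); rewrite comp_assoc ?pair1 ?pair2 ?comp_id_l
  // ey comp_assoc.
Qed.

Lemma umg_mul_unit_l Z (x y : hom Z (rg_1 X)) (xy : rg_d X ∘ x = rg_c X ∘ y) :
  x = rg_e X ∘ (rg_c X ∘ y) -> umg_mul m xy = y.
Proof.
move=> ex; rewrite -[RHS]comp_id_l -(umg_e2 m) -comp_assoc; congr (_ ∘ _).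
by apply: (pb_uniq (rg_2 lp X)); rewrite comp_assoc ?pair1 ?pair2 ?comp_id_l
  // ex comp_assoc.
Qed.

Lemma umg_mul_pb : umg_mul m (pb_comm (rg_2 lp X)) = umg_m m.
Proof.
rewrite -[RHS]comp_id_r; congr (_ ∘ _).
by apply: (pb_uniq (rg_2 lp X)); rewrite ?pair1 ?pair2 comp_id_r.
Qed.

Lemma d_umg_mul Z (x y : hom Z (rg_1 X)) (xy : rg_d X ∘ x = rg_c X ∘ y) :
  rg_d X ∘ umg_mul m xy = rg_d X ∘ y.
Proof. by rewrite (comp_tail2 _ (umg_d m)) pair2. Qed.

Lemma c_umg_mul Z (x y : hom Z (rg_1 X)) (xy : rg_d X ∘ x = rg_c X ∘ y) :
  rg_c X ∘ umg_mul m xy = rg_c X ∘ x.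
Proof. by rewrite (comp_tail2 _ (umg_c m)) pair1. Qed.

End UMGMul.

Lemma umg_hom_mul (K : Category) (lp : LocalProducts K) (X Y : RG K)
    (m : UMGStr lp X) (m' : UMGStr lp Y) (f : hom X Y) Z
    (x y : hom Z (rg_1 X)) (xy : rg_d X ∘ x = rg_c X ∘ y)
    (xy' : rg_d Y ∘ (rh_1 f ∘ x) = rg_c Y ∘ (rh_1 f ∘ y)) :
  umg_hom m m' f -> rh_1 f ∘ umg_mul m xy = umg_mul m' xy'.
Proof.
rewrite /umg_hom /umg_mul comp_assoc => ->; rewrite -comp_assoc; congr (_ ∘ _).
by apply: (pb_uniq (rg_2 lp Y)); rewrite comp_assoc ?pair1 ?pair2 -comp_assoc
  ?pair1 ?pair2.
Qed.

(** * The reflexive graph of kernel triples *)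

Section KernelGraph.
Context (K : Category) (lp : LocalProducts K).

Section Object.
Context (S : SpanOb K) (kS : KernelPairs S).

Definition kp_unit : hom (sp_D S) (kp_ob lp kS) :=
  kp_triple lp kS (erefl (sp_d S ∘ 1_(sp_D S))) erefl.

(** A triple <x,y,z> is an arrow from x to z, with identities <x,x,x>. The span part is the kernel
    pair construction of [S], which is how closure of M enters. *)
Definition kernel_graph : RG K :=
  MkRG (dom_triple lp kS (erefl (sp_d S ∘ 1_(sp_D S))) erefl)
    (cod_triple lp kS (erefl (sp_d S ∘ 1_(sp_D S))) erefl).

Lemma kp_unit_comp Z (x : hom Z (sp_D S)) :
  kp_unit ∘ x = kp_triple lp kS (erefl (sp_d S ∘ x)) erefl.
Proof.
by apply: eq_triple; rewrite comp_assoc ?dom_triple ?mid_triple ?cod_triple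
  comp_id_l.
Qed.

Context (m : UMGStr lp kernel_graph).

Let a := kp_dom lp kS.
Let b := kp_mid lp kS.
Let c := kp_cod lp kS.
Let ab : sp_d S ∘ a = sp_d S ∘ b := kp_dom_mid lp kS.
Let bc : sp_c S ∘ b = sp_c S ∘ c := kp_mid_cod lp kS.
Let u : hom (kp_ob lp kS) (kp_ob lp kS) := kp_triple lp kS (esym ab) erefl.
Let v : hom (kp_ob lp kS) (kp_ob lp kS) := kp_triple lp kS erefl (esym bc).

Lemma kernel_graph_legs : rg_d kernel_graph ∘ u = rg_c kernel_graph ∘ v.
Proof. by rewrite /= dom_triple cod_triple. Qed.

(* The arrows $\langle y,x,x\rangle$ from $y$ to $x$ and $\langle z,z,y\rangle$
   from $z$ to $y$ have a composite $\langle z,p(x,y,z),x\rangle$. *)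
Definition mid_mul : hom (kp_ob lp kS) (sp_D S) :=
  kp_mid lp kS ∘ umg_mul m kernel_graph_legs.

Lemma mid_mul_triple Z (x y z : hom Z (sp_D S))
    (xy : sp_d S ∘ x = sp_d S ∘ y) (yz : sp_c S ∘ y = sp_c S ∘ z)
    (h : rg_d kernel_graph ∘ kp_triple lp kS (esym xy) erefl
      = rg_c kernel_graph ∘ kp_triple lp kS erefl (esym yz)) :
  mid_mul ∘ kp_triple lp kS xy yz = kp_mid lp kS ∘ umg_mul m h.
Proof.
have eu : u ∘ kp_triple lp kS xy yz = kp_triple lp kS (esym xy) erefl.
  by apply: eq_triple; rewrite comp_assoc ?dom_triple ?mid_triple ?cod_triple
    ?dom_triple ?mid_triple.
have ev : v ∘ kp_triple lp kS xy yz = kp_triple lp kS erefl (esym yz).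
  by apply: eq_triple; rewrite comp_assoc ?dom_triple ?mid_triple ?cod_triple
    ?mid_triple ?cod_triple.
rewrite /mid_mul -comp_assoc; congr (_ ∘ _).
have h' : rg_d kernel_graph ∘ (u ∘ kp_triple lp kS xy yz)
    = rg_c kernel_graph ∘ (v ∘ kp_triple lp kS xy yz) by rewrite eu ev.
by apply: etrans (umg_mul_comp _ _ h') _; apply: umg_mul_eq.
Qed.

(** For z = y the second arrow <y,y,y> is an identity, so the composite is <y,x,x>, with middle
    component x. *)
Lemma mid_mul_xyy Z (x y : hom Z (sp_D S)) (xy : sp_d S ∘ x = sp_d S ∘ y) :
  mid_mul ∘ kp_triple lp kS xy erefl = x.
Proof.
rewrite mid_mul_triple; first by rewrite /= dom_triple cod_triple.
move=> h; rewrite umg_mul_unit_r ?mid_triple //= dom_triple kp_unit_comp.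
exact: triple_eq.
Qed.

Lemma mid_mul_yyz Z (y z : hom Z (sp_D S)) (yz : sp_c S ∘ y = sp_c S ∘ z) :
  mid_mul ∘ kp_triple lp kS erefl yz = z.
Proof.
rewrite mid_mul_triple; first by rewrite /= dom_triple cod_triple.
move=> h; rewrite umg_mul_unit_l ?mid_triple //= cod_triple kp_unit_comp.
exact: triple_eq.
Qed.

(** Under d, the middle component of a triple agrees with its domain, and the domain of the
    composite is that of its second arrow, z. *)
Lemma mid_mul_d : sp_d S ∘ mid_mul = sp_d S ∘ kp_cod lp kS.
Proof.
rewrite /mid_mul -(comp_tail2 _ (kp_dom_mid lp kS)); congr (_ ∘ _).
by have /= := d_umg_mul m kernel_graph_legs; rewrite dom_triple.
Qed.

Lemma mid_mul_c : sp_c S ∘ mid_mul = sp_c S ∘ kp_dom lp kS.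
Proof.
rewrite /mid_mul (comp_tail2 _ (kp_mid_cod lp kS)); congr (_ ∘ _).
by have /= := c_umg_mul m kernel_graph_legs; rewrite cod_triple.
Qed.

Definition graph_pregroupoid : PregroupoidStr lp kS :=
  MkPregroupoidStr mid_mul_xyy mid_mul_yyz mid_mul_d mid_mul_c.

End Object.

Section Map.
Context (S T : SpanOb K) (kS : KernelPairs S) (kT : KernelPairs T).
Context (h : SpanHom S T).

Lemma kernel_graph_hom_e :
  kp_unit kT ∘ sh_D h = kp_map lp kS kT h ∘ kp_unit kS.
Proof.
by rewrite kp_unit_comp; symmetry; apply: eq_triple;
  rewrite comp_assoc (kp_map_dom, kp_map_mid, kp_map_cod) -comp_assoc
  (dom_triple, mid_triple, cod_triple) comp_id_r.
Qed.

Definition kernel_graph_hom : hom (kernel_graph kS) (kernel_graph kT) :=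
  @MkRGHom K (kernel_graph kS) (kernel_graph kT) (kp_map lp kS kT h) (sh_D h)
    (kp_map_dom lp kS kT h) (kp_map_cod lp kS kT h) kernel_graph_hom_e.

(** [kp_map] acts componentwise, hence carries the two composed arrows over [S] to those over [T];
    it also preserves their composite by assumption. *)
Lemma mid_mul_natural (m : UMGStr lp (kernel_graph kS))
    (m' : UMGStr lp (kernel_graph kT)) :
  umg_hom m m' kernel_graph_hom ->
  sh_D h ∘ mid_mul m = mid_mul m' ∘ kp_map lp kS kT h.
Proof.
move=> nat; rewrite /mid_mul comp_assoc -(kp_map_mid _ _ kT).
rewrite -[LHS]comp_assoc -[RHS]comp_assoc.
set u := kp_triple lp kS (esym _) erefl; set v := kp_triple lp kS erefl _.
set u' := kp_triple lp kT (esym _) erefl; set v' := kp_triple lp kT erefl _.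
have eu : kp_map lp kS kT h ∘ u = u' ∘ kp_map lp kS kT h.
  by apply: kp_uniq; rewrite !comp_assoc (kp_map_dom, kp_map_mid, kp_map_cod)
    -comp_assoc (dom_triple, mid_triple, cod_triple)
    (dom_triple, mid_triple, cod_triple) (kp_map_dom, kp_map_mid, kp_map_cod).
have ev : kp_map lp kS kT h ∘ v = v' ∘ kp_map lp kS kT h.
  by apply: kp_uniq; rewrite !comp_assoc (kp_map_dom, kp_map_mid, kp_map_cod)
    -comp_assoc (dom_triple, mid_triple, cod_triple)
    (dom_triple, mid_triple, cod_triple) (kp_map_dom, kp_map_mid, kp_map_cod).
have legs : rg_d (kernel_graph kT) ∘ (u' ∘ kp_map lp kS kT h)
    = rg_c (kernel_graph kT) ∘ (v' ∘ kp_map lp kS kT h).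
  by rewrite !comp_assoc /= dom_triple cod_triple.
have legs' : rg_d (kernel_graph kT) ∘ (rh_1 kernel_graph_hom ∘ u)
    = rg_c (kernel_graph kT) ∘ (rh_1 kernel_graph_hom ∘ v) by rewrite /= eu ev.
have e := umg_hom_mul (kernel_graph_legs kS) legs' nat.
have e' := umg_mul_eq m' legs' legs eu ev.
congr (_ ∘ _); exact: etrans (etrans e e') (esym (umg_mul_comp _ _ legs)).
Qed.

End Map.
End KernelGraph.

(** * Natural pregroupoids *)

Section Main.
Context (K : Category) (lp : LocalProducts K) (M : Span K -> Prop).
Context (kp : forall S : Span K, M S -> KernelPairs S).

Definition natural_pregroupoids : Prop :=
  exists p : forall X : SpanM M, pregrpd_str lp kp X,
    forall X Y (h : hom X Y), pregrpd_hom (p X) (p Y) h.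

Definition natural_umg : Prop :=
  exists m : forall X : RGM M, UMGStr lp (sval X),
    forall X Y (f : hom X Y), umg_hom (m X) (m Y) f.

Lemma section_UMG_natural : has_section (UMG_to_RG lp M) -> natural_umg.
Proof.
apply: (section_natural_family (F := UMG_to_RG lp M)
  (T := fun X : RGM M => UMGStr lp (sval X))
  (R := fun X Y m m' f => umg_hom (X := sval X) (Y := sval Y) m m' f)
  (a := fun A => projT2 (sval A))).
by move=> A B u; apply: svalP u.
Qed.

Lemma section_Cat_natural : has_section (Cat_to_RG lp M) -> natural_umg.
Proof.
apply: (section_natural_family (F := Cat_to_RG lp M)
  (T := fun X : RGM M => UMGStr lp (sval X))
  (R := fun X Y m m' f => umg_hom (X := sval X) (Y := sval Y) m m' f)
  (a := fun A => projT2 (sval (sval A)))).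
by move=> A B u; apply: svalP u.
Qed.

Lemma section_Grpd_natural : has_section (Grpd_to_RG lp M) -> natural_umg.
Proof.
apply: (section_natural_family (F := Grpd_to_RG lp M)
  (T := fun X : RGM M => UMGStr lp (sval X))
  (R := fun X Y m m' f => umg_hom (X := sval X) (Y := sval Y) m m' f)
  (a := fun A => projT2 (sval (sval (sval A))))).
by move=> A B u; apply: svalP u.
Qed.

Lemma section_PreGrpd_natural :
  has_section (PreGrpd_to_Span lp kp) -> natural_pregroupoids.
Proof.
apply: (section_natural_family (F := PreGrpd_to_Span lp kp)
  (T := fun X : SpanM M => pregrpd_str lp kp X)
  (R := fun X Y p q h => pregrpd_hom p q h) (a := fun A => projT2 A)).
by move=> A B u; apply: svalP u.
Qed.

(** The kernel kite of a span in M has that span as its direction, so it is an object of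
    DiKite(C,M). *)
Lemma section_MKite_natural :
  has_section (MKite_to_DiKite lp M) -> natural_pregroupoids.
Proof.
case/(section_natural_family (F := MKite_to_DiKite lp M)
  (T := fun X : DiKiteM M => MKiteStr lp (sval X))
  (R := fun X Y m m' f => mkite_hom (X := sval X) (Y := sval Y) m m' f)
  (a := fun A => projT2 (sval A))).
  by move=> A B u; apply: svalP u.
move=> m nat.
pose kite (X : SpanM M) : DiKiteM M :=
  exist _ (kernel_kite (kp (svalP X)) : DiKite K) (svalP X).
exists (fun X => kite_pregroupoid (m (kite X))) => X Y h.
exact: (nat (kite X) (kite Y) (kernel_kite_hom _ _ h)).
Qed.

Hypothesis M_kernel_pairs : closed_under_kernel_pairs lp kp.

Lemma natural_umg_pregroupoids : natural_umg -> natural_pregroupoids.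
Proof.
case=> m nat.
pose graph (X : SpanM M) : RGM M :=
  exist _ (kernel_graph lp (kp (svalP X)) : RG K) (M_kernel_pairs (svalP X)).
exists (fun X => graph_pregroupoid (m (graph X))) => X Y h.
exact/mid_mul_natural/(nat (graph X) (graph Y)).
Qed.

(** * Natural pregroupoids imply condition (11) *)

Definition unique_diagonals : Prop :=
  forall (A C E D D0 D1 : K)
    (p1 : hom E A) (e1 : hom A E) (p2 : hom E C) (e2 : hom C E)
    (alpha : hom A D) (beta : hom E D) (gamma : hom C D)
    (d : hom D D0) (c : hom D D1),
    jointly_monic p1 p2 ->
    M (MkSpan d c) -> M (MkSpan p1 p2) ->
    p1 ∘ e1 = 1_A -> p2 ∘ e2 = 1_C ->
    (e1 ∘ p1) ∘ (e2 ∘ p2) = (e2 ∘ p2) ∘ (e1 ∘ p1) ->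
    alpha ∘ (p1 ∘ e2 ∘ p2) = beta -> beta = gamma ∘ (p2 ∘ e1 ∘ p1) ->
    d ∘ alpha ∘ p1 = d ∘ alpha ∘ (p1 ∘ e2 ∘ p2) ->
    c ∘ gamma ∘ p2 = c ∘ gamma ∘ (p2 ∘ e1 ∘ p1) ->
    exists! m : hom E D,
      [/\ m ∘ e1 = alpha, m ∘ e2 = gamma,
          d ∘ m = d ∘ gamma ∘ p2 & c ∘ m = c ∘ alpha ∘ p1].

Lemma natural_pregroupoids_diagonals : natural_pregroupoids -> unique_diagonals.
Proof.
case=> p nat A C E D D0 D1 p1 e1 p2 e2 alpha beta gamma d c jm MD ME.
move=> pe1 pe2 eC ab bg dab cgb.
pose SD : SpanM M := exist _ (MkSpan d c : Span K) MD.
pose SE : SpanM M := exist _ (MkSpan p1 p2 : Span K) ME.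
pose SL : SpanM M :=
  exist _ (kp_span lp (kp (svalP SE)) : Span K) (M_kernel_pairs (svalP SE)).
have xy : d ∘ (alpha ∘ p1) = d ∘ beta.
  by rewrite -ab comp_assoc dab -comp_assoc.
have yz : c ∘ beta = c ∘ (gamma ∘ p2).
  by rewrite bg [RHS]comp_assoc cgb -[RHS]comp_assoc.
have alpha_e : alpha ∘ p1 ∘ e2 = beta ∘ e2.
  by rewrite -ab -!comp_assoc pe2 comp_id_r.
have gamma_e : beta ∘ e1 = gamma ∘ p2 ∘ e1.
  by rewrite bg -!comp_assoc pe1 comp_id_r.
have b1 : p1 ∘ (e1 ∘ p1 ∘ (e2 ∘ p2)) = p1 ∘ e2 ∘ p2.
  by rewrite !comp_assoc pe1 comp_id_l.
have b2 : p2 ∘ (e1 ∘ p1 ∘ (e2 ∘ p2)) = p2 ∘ e1 ∘ p1.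
  by rewrite eC !comp_assoc pe2 comp_id_l.
exists (pg_p (p SD) ∘ kp_triple lp (kp (svalP SD)) xy yz); split.
  split.
  (* Along e1 the last two components agree by [gamma_e], so a unit law leaves alpha p1 e1 =
     alpha. *)
  - have xy1 : d ∘ (alpha ∘ p1 ∘ e1) = d ∘ (beta ∘ e1).
      by rewrite !comp_assoc -(comp_assoc d) xy.
    have yz1 : c ∘ (beta ∘ e1) = c ∘ (gamma ∘ p2 ∘ e1).
      by rewrite !comp_assoc -(comp_assoc c gamma) -yz.
    rewrite -comp_assoc (triple_comp (S := sval SD) _ _ _ _ xy1 yz1) pg_unit_r //.
    by rewrite -comp_assoc pe1 comp_id_r.
  - have xy2 : d ∘ (alpha ∘ p1 ∘ e2) = d ∘ (beta ∘ e2).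
      by rewrite !comp_assoc -(comp_assoc d) xy.
    have yz2 : c ∘ (beta ∘ e2) = c ∘ (gamma ∘ p2 ∘ e2).
      by rewrite !comp_assoc -(comp_assoc c gamma) -yz.
    rewrite -comp_assoc (triple_comp (S := sval SD) _ _ _ _ xy2 yz2) pg_unit_l //.
    by rewrite -comp_assoc pe2 comp_id_r.
  - by rewrite (pg_triple_d (p SD)) comp_assoc.
  - by rewrite (pg_triple_c (p SD)) comp_assoc.
(* The legs of m are crossed, so it is not a morphism from the span (E, p1, p2);
   but E has a pregroupoid structure q, which crosses the legs of the span of
   its kernel triples, and m ∘ q is a span morphism. Naturality at m ∘ q,
   evaluated at three kernel triples of E chosen so that their composite is sent
   to 1 by q, expresses m through alpha, beta and gamma. *)
move=> m [me1 me2 md mc].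
pose q : hom (sp_D (sval SL)) E := pg_p (p SE).
(* Since p2 q = p2 dom and p1 q = p1 cod, d m q factors through dom and c m q through cod. *)
have hd : d ∘ (m ∘ q) = d ∘ gamma ∘ p2 ∘ kp_dom lp (kp (svalP SE)).
  by rewrite comp_assoc md -comp_assoc (pg_c (p SE)) comp_assoc.
have hc : c ∘ (m ∘ q) = c ∘ alpha ∘ p1 ∘ kp_cod lp (kp (svalP SE)).
  by rewrite comp_assoc mc -comp_assoc (pg_d (p SE)) comp_assoc.
pose h : hom SL SD := @MkSpanHom K (sval SL) (sval SD) _ _ _ hd hc.
have t1 : p1 ∘ (e1 ∘ p1) = p1 ∘ 1_E.
  by rewrite comp_assoc pe1 comp_id_l comp_id_r.
have t2 : p2 ∘ 1_E = p2 ∘ (e2 ∘ p2).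
  by rewrite comp_assoc pe2 comp_id_l comp_id_r.
pose kE := kp (svalP SE).
(* Here x = <e1 p1, e1 p1, e1 p1>, y = <e1 p1, 1, e2 p2> and z = <e2 p2, e2 p2, e2 p2>; x and y
   share dom, y and z share cod. *)
pose x := kp_triple lp kE (erefl (p1 ∘ (e1 ∘ p1))) erefl.
pose y := kp_triple lp kE t1 t2.
pose z := kp_triple lp kE (erefl (p1 ∘ (e2 ∘ p2))) erefl.
have xy' : kp_dom lp kE ∘ x = kp_dom lp kE ∘ y by rewrite !dom_triple.
have yz' : kp_cod lp kE ∘ y = kp_cod lp kE ∘ z by rewrite !cod_triple.
pose w := kp_triple lp (kp (svalP SL)) xy' yz'.
have qx : q ∘ x = e1 ∘ p1 by exact: (pg_xyy (p SE)).
have qz : q ∘ z = e2 ∘ p2 by exact: (pg_xyy (p SE)).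
(* As [q] crosses the legs, p1 q y = p1 e2 p2 and p2 q y = p2 e1 p1, the coordinates computed in
   [b1] and [b2]. *)
have qy : q ∘ y = e1 ∘ p1 ∘ (e2 ∘ p2).
  apply: jm; rewrite ?b1 ?b2.
    by rewrite (pg_triple_d (p SE)) comp_assoc.
  by rewrite (pg_triple_c (p SE)) comp_assoc.
(* Crossing twice, the first coordinate is p1 after cod of x, that is p1 e1 p1 = p1, and the second
   is p2 after dom of z, that is p2 e2 p2 = p2. *)
have qw : q ∘ (pg_p (p SL) ∘ w) = 1_E.
  apply: jm.
    rewrite (comp_tail2 _ (pg_d (p SE))) (pg_triple_c (p SL)) cod_triple.
    exact: t1.
  rewrite (comp_tail2 _ (pg_c (p SE))) (pg_triple_d (p SL)) dom_triple.
  exact: esym t2.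
rewrite -[RHS]comp_id_r -qw comp_assoc.
rewrite [RHS](comp_tail2 _ (nat SL SD h)); congr (_ ∘ _); symmetry.
apply: eq_triple; rewrite comp_assoc.
- rewrite kp_map_dom -comp_assoc dom_triple -[LHS]comp_assoc qx comp_assoc.
  by rewrite me1.
- rewrite kp_map_mid -comp_assoc mid_triple -[LHS]comp_assoc qy.
  by rewrite !comp_assoc me1 -ab !comp_assoc.
- rewrite kp_map_cod -comp_assoc cod_triple -[LHS]comp_assoc qz comp_assoc.
  by rewrite me2.
Qed.


(** * Consequences of the unique extension property *)

Hypothesis M_local_products : contains_local_products lp M.
Hypothesis diag : unique_diagonals.

(** The laws of [MKiteStr] on a bare morphism, ordered as in the conclusion of (11), so that [diag]
    applies directly. *)
Definition is_kite_mul (X : DiKiteOb K)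
    (m : hom (lp (dk_cospan X)) (sp_D (dk_span X))) : Prop :=
  [/\ m ∘ lp_e1 lp (dk_cospan X) = dk_alpha X,
      m ∘ lp_e2 lp (dk_cospan X) = dk_gamma X,
      sp_d (dk_span X) ∘ m
        = sp_d (dk_span X) ∘ dk_gamma X ∘ pb2 (lp (dk_cospan X))
    & sp_c (dk_span X) ∘ m
        = sp_c (dk_span X) ∘ dk_alpha X ∘ pb1 (lp (dk_cospan X))].

Lemma mk_is_kite_mul (X : DiKiteOb K) (m : MKiteStr lp X) :
  is_kite_mul (mk_m m).
Proof. by case: m. Qed.

(** The local product is an instance of (11): its span is in M, its projections are jointly monic,
    the two idempotents commute because f pi1 = g pi2, and the middle morphism is beta g pi2. *)
Lemma kite_mul_unique (X : DiKiteOb K) :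
  M (dk_span X) -> exists! m, is_kite_mul (X := X) m.
Proof.
case: X => X [D D0 D1 d c] alpha beta gamma /= ar gs da cg MD.
rewrite /is_kite_mul /=.
have a1 Z (k : hom Z _) : pb1 (lp X) ∘ (lp_e1 lp X ∘ k) = k.
  by rewrite comp_assoc pair1 comp_id_l.
have a2 Z (k : hom Z _) :
    pb2 (lp X) ∘ (lp_e1 lp X ∘ k) = sc_s X ∘ (sc_f X ∘ k).
  by rewrite comp_assoc pair2 comp_assoc.
have a3 Z (k : hom Z _) :
    pb1 (lp X) ∘ (lp_e2 lp X ∘ k) = sc_r X ∘ (sc_g X ∘ k).
  by rewrite comp_assoc pair1 comp_assoc.
have a4 Z (k : hom Z _) : pb2 (lp X) ∘ (lp_e2 lp X ∘ k) = k.
  by rewrite comp_assoc pair2 comp_id_l.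
have a5 Z (k : hom Z _) : sc_f X ∘ (sc_r X ∘ k) = k.
  by rewrite comp_assoc sc_fr comp_id_l.
have a6 Z (k : hom Z _) : sc_g X ∘ (sc_s X ∘ k) = k.
  by rewrite comp_assoc sc_gs comp_id_l.
have aE := (a1, a2, a3, a4, a5, a6).
have fg := pb_comm (lp X).
apply: (diag (beta := alpha ∘ (pb1 (lp X) ∘ lp_e2 lp X ∘ pb2 (lp X)))
  _ MD (M_local_products X) (pair1 _ _) (pair2 _ _)) => //.
- by move=> Z u v; apply: pb_uniq.
- by apply: (pb_uniq (lp X)); rewrite -!comp_assoc !aE fg.
- by rewrite -!comp_assoc !aE (comp_tail _ ar) (comp_tail _ gs) fg.
- by rewrite -!comp_assoc !aE (comp_tail _ ar) -fg !comp_assoc da.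
- by rewrite -!comp_assoc !aE (comp_tail _ gs) fg !comp_assoc cg.
Qed.

Lemma mkite_of (X : DiKiteOb K) : M (dk_span X) -> MKiteStr lp X.
Proof.
move/kite_mul_unique/constructive_indefinite_description.
by case=> m [[me1 me2 md mc] _]; exists m.
Qed.

Lemma kite_mul_inj (X : DiKiteOb K) (m m' : hom (lp (dk_cospan X)) _) :
  M (dk_span X) -> is_kite_mul m -> is_kite_mul m' -> m = m'.
Proof.
move=> MX hm hm'; case: (kite_mul_unique MX) => u [_ hu].
by rewrite -(hu _ hm) -(hu _ hm').
Qed.

Lemma mkite_str_eq (X : DiKiteOb K) (m m' : MKiteStr lp X) :
  M (dk_span X) -> m = m'.
Proof.
move=> MX; have := kite_mul_inj MX (mk_is_kite_mul m) (mk_is_kite_mul m').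
case: m m' => [m md mc me1 me2] [m' md' mc' me1' me2'] /= e.
by case: _ / e in md' mc' me1' me2' *; congr MkMKiteStr;
  apply: proof_irrelevance.
Qed.

(** Both sides are multiplications on one kite, with the cospan of [X], the direction of [Y] and
    alpha, beta, gamma of [X] followed by h_D; so they coincide. *)
Lemma mkite_natural (X Y : DiKite K) (m : MKiteStr lp X) (m' : MKiteStr lp Y)
    (h : hom X Y) :
  M (dk_span Y) -> mkite_hom m m' h.
Proof.
move=> MY; pose u := kh_span h.
have ar : sh_D u ∘ dk_alpha X ∘ sc_r (dk_cospan X) = sh_D u ∘ dk_beta X.
  by rewrite -comp_assoc dk_alpha_r.
have gs : sh_D u ∘ dk_gamma X ∘ sc_s (dk_cospan X) = sh_D u ∘ dk_beta X.
  by rewrite -comp_assoc dk_gamma_s.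
have da : sp_d (dk_span Y) ∘ (sh_D u ∘ dk_alpha X)
    = sp_d (dk_span Y) ∘ (sh_D u ∘ dk_beta X) ∘ sc_f (dk_cospan X).
  by rewrite !comp_assoc sh_d -!comp_assoc dk_d -comp_assoc.
have cg : sp_c (dk_span Y) ∘ (sh_D u ∘ dk_beta X) ∘ sc_g (dk_cospan X)
    = sp_c (dk_span Y) ∘ (sh_D u ∘ dk_gamma X).
  by rewrite !comp_assoc sh_c -!comp_assoc -dk_c -comp_assoc.
apply: (@kite_mul_inj (MkDiKite ar gs da cg)) => //.
- split=> /=.
  + by rewrite -comp_assoc mk_e1.
  + by rewrite -comp_assoc mk_e2.
  + by rewrite !comp_assoc sh_d -!comp_assoc mk_d !comp_assoc.
  + by rewrite !comp_assoc sh_c -!comp_assoc mk_c !comp_assoc.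
(* The induced map preserves the inclusions because h commutes with the sections s and r as well. *)
- have e1 : pb_map (lp (dk_cospan X)) (lp (dk_cospan Y)) (kh_f h) (kh_g h)
      ∘ lp_e1 lp (dk_cospan X) = lp_e1 lp (dk_cospan Y) ∘ kh_A h.
    apply: (pb_uniq (lp (dk_cospan Y))); rewrite !comp_assoc ?pair1 ?pair2.
      by rewrite -comp_assoc pair1 comp_id_r comp_id_l.
    by rewrite -comp_assoc pair2 comp_assoc -kh_s -!comp_assoc kh_f.
  have e2 : pb_map (lp (dk_cospan X)) (lp (dk_cospan Y)) (kh_f h) (kh_g h)
      ∘ lp_e2 lp (dk_cospan X) = lp_e2 lp (dk_cospan Y) ∘ kh_C h.
    apply: (pb_uniq (lp (dk_cospan Y))); rewrite !comp_assoc ?pair1 ?pair2.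
      by rewrite -comp_assoc pair1 comp_assoc -kh_r -!comp_assoc kh_g.
    by rewrite -comp_assoc pair2 comp_id_r comp_id_l.
  split=> /=.
  + by rewrite -comp_assoc e1 comp_assoc mk_e1 kh_alpha.
  + by rewrite -comp_assoc e2 comp_assoc mk_e2 kh_gamma.
  + by rewrite comp_assoc mk_d -comp_assoc pair2 -kh_gamma !comp_assoc.
  + by rewrite comp_assoc mk_c -comp_assoc pair1 -kh_alpha !comp_assoc.
Qed.

Lemma diagonals_MKite_iso : is_isomorphism (MKite_to_DiKite lp M).
Proof.
pose g (X : DiKiteM M) : MKiteM lp M :=
  exist _ (existT _ (sval X) (mkite_of (svalP X)) : MKite lp) (svalP X).
pose lift (A B : MKiteM lp M)
    (u : hom (MKite_to_DiKite lp M A) (MKite_to_DiKite lp M B)) : hom A B :=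
  exist _ (u : hom (projT1 (sval A)) (projT1 (sval B)))
    (mkite_natural _ _ u (svalP B)).
apply: (iso_criterion (g := g) (lift := lift)) => //.
- by move=> X; apply: sub_eq.
- by case=> [[X m] MX]; apply: sub_eq; congr existT; apply: mkite_str_eq.
- by move=> A B u v e; apply: sub_eq.
Qed.

(** * Pregroupoids as multiplications on kernel kites *)

Lemma pregroupoid_str_eq (S : SpanOb K) (kS : KernelPairs S)
    (p q : PregroupoidStr lp kS) :
  M S -> p = q.
Proof.
move=> MS; have := mkite_str_eq (pregroupoid_kite p) (pregroupoid_kite q) MS.
move/(f_equal (@mk_m _ _ _)).
case: p q => [p p1 p2 pd pc] [q q1 q2 qd qc] /= e.
by case: _ / e in q1 q2 qd qc *; congr MkPregroupoidStr;
  apply: proof_irrelevance.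
Qed.

Lemma diagonals_PreGrpd_iso : is_isomorphism (PreGrpd_to_Span lp kp).
Proof.
pose pg (X : SpanM M) : pregrpd_str lp kp X :=
  kite_pregroupoid (@mkite_of (kernel_kite (kp (svalP X))) (svalP X)).
pose g (X : SpanM M) : PreGrpdM lp kp := existT _ X (pg X).
have nat (X Y : PreGrpdM lp kp) (h : hom (projT1 X) (projT1 Y)) :
    pregrpd_hom (projT2 X) (projT2 Y) h.
  have := mkite_natural (pregroupoid_kite (projT2 X))
    (pregroupoid_kite (projT2 Y))
    (kernel_kite_hom (kp (svalP (projT1 X))) (kp (svalP (projT1 Y))) h).
  by apply; apply: svalP.
pose lift (A B : PreGrpdM lp kp)
    (u : hom (PreGrpd_to_Span lp kp A) (PreGrpd_to_Span lp kp B)) : hom A B :=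
  exist _ (u : hom (projT1 A) (projT1 B)) (nat A B u).
apply: (iso_criterion (g := g) (lift := lift)) => //.
- by case=> X p; congr existT; apply: pregroupoid_str_eq; apply: svalP.
- by move=> A B u v e; apply: sub_eq.
Qed.

(** * Multiplication of reflexive graphs *)

Section GraphKite.
Context (X : RGOb K).

Lemma graph_kite_d :
  rg_d X ∘ 1_(rg_1 X) = rg_d X ∘ rg_e X ∘ rg_d X.
Proof. by rewrite rg_de comp_id_l comp_id_r. Qed.

Lemma graph_kite_c :
  rg_c X ∘ rg_e X ∘ rg_c X = rg_c X ∘ 1_(rg_1 X).
Proof. by rewrite rg_ce comp_id_l comp_id_r. Qed.

(** With alpha and gamma identities and beta = e, the laws of a multiplication become those of a
    unital multiplicative graph. *)
Definition graph_kite : DiKiteOb K :=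
  @MkDiKite K (rg_cospan X) (MkSpan (rg_d X) (rg_c X)) _ _ _
    (comp_id_l (rg_e X)) (comp_id_l (rg_e X)) graph_kite_d graph_kite_c.

Lemma kite_umg (m : MKiteStr lp graph_kite) : UMGStr lp X.
Proof.
case: m => m; rewrite /= !comp_id_r => md mc me1 me2.
exact: MkUMGStr md mc me1 me2.
Qed.

(** Kept transparent because later proofs need its underlying morphism to compute to [umg_m m]. *)
Lemma umg_kite (m : UMGStr lp X) : MKiteStr lp graph_kite.
Proof.
exists (umg_m m); rewrite /= ?comp_id_r.
- exact: umg_d.
- exact: umg_c.
- exact: umg_e1.
- exact: umg_e2.
Defined.

End GraphKite.

Lemma umg_str_eq (X : RG K) (m m' : UMGStr lp X) : RG_in M X -> m = m'.
Proof.
move=> MX; have := mkite_str_eq (umg_kite m) (umg_kite m') MX.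
move/(f_equal (@mk_m _ _ _)).
case: m m' => [m md mc me1 me2] [m' md' mc' me1' me2'] /= e.
by case: _ / e in md' mc' me1' me2' *; congr MkUMGStr; apply: proof_irrelevance.
Qed.

Definition graph_kite_hom (X Y : RG K) (f : hom X Y) :
    DiKiteHom (graph_kite X) (graph_kite Y) :=
  @MkDiKiteHom K (graph_kite X) (graph_kite Y) _ _ _
    (@MkSpanHom K (rg_span X) (rg_span Y) _ _ _ (rh_d f) (rh_c f))
    (rh_d f) (rh_e f) (rh_c f) (rh_e f)
    (esym (sq_id (rh_1 f))) (rh_e f) (esym (sq_id (rh_1 f))).

Lemma umg_natural (X Y : RG K) (m : UMGStr lp X) (m' : UMGStr lp Y)
    (f : hom X Y) :
  RG_in M Y -> umg_hom m m' f.
Proof.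
exact: (mkite_natural (umg_kite m) (umg_kite m') (graph_kite_hom f)).
Qed.

Section Associativity.
Context (X : RG K) (m : UMGStr lp X) (MX : RG_in M X).

Let C2 := rg_2 lp X.

(** Its pullback is the object of composable triples, as pairs <x,y>, <y,z>; the two inclusions are
    the triples where z, respectively x, is an identity. *)
Definition assoc_cospan : SplitCospan K :=
  @MkSplitCospan K C2 (rg_1 X) C2 (pb2 C2) (lp_e2 lp (rg_cospan X)) (pb1 C2)
    (lp_e1 lp (rg_cospan X)) (pair2 _ _) (pair1 _ _).

Lemma assoc_kite_d :
  rg_d X ∘ umg_m m = rg_d X ∘ 1_(rg_1 X) ∘ pb2 C2.
Proof. by rewrite umg_d comp_id_r. Qed.

Lemma assoc_kite_c :
  rg_c X ∘ 1_(rg_1 X) ∘ pb1 C2 = rg_c X ∘ umg_m m.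
Proof. by rewrite umg_c comp_id_r. Qed.

(* A multiplication on this kite is a ternary composition which is binary
   composition as soon as one of the outer arrows is an identity. *)
Definition assoc_kite : DiKiteOb K :=
  @MkDiKite K assoc_cospan (rg_span X) _ _ _ (umg_e2 m) (umg_e1 m)
    assoc_kite_d assoc_kite_c.

Lemma umg_assoc : umg_associative m.
Proof.
move=> Z x y z xy yz; pose P := lp assoc_cospan.
have bE : pb2 C2 ∘ pb1 P = pb1 C2 ∘ pb2 P := pb_comm P.
have p11 : pb1 P ∘ lp_e1 lp assoc_cospan = 1_C2 := pair1 _ _.
have p21 : pb2 P ∘ lp_e1 lp assoc_cospan = lp_e1 lp (rg_cospan X) ∘ pb2 C2 :=
  pair2 _ _.
have p12 : pb1 P ∘ lp_e2 lp assoc_cospan = lp_e2 lp (rg_cospan X) ∘ pb1 C2 :=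
  pair1 _ _.
have p22 : pb2 P ∘ lp_e2 lp assoc_cospan = 1_C2 := pair2 _ _.
have h1 : rg_d X ∘ (umg_m m ∘ pb1 P) = rg_c X ∘ (pb2 C2 ∘ pb2 P).
  by rewrite (comp_tail2 _ (umg_d m)) bE (comp_tail2 _ (pb_comm C2)).
have h2 : rg_d X ∘ (pb1 C2 ∘ pb1 P) = rg_c X ∘ (umg_m m ∘ pb2 P).
  by rewrite (comp_tail2 _ (umg_c m)) -bE (comp_tail2 _ (pb_comm C2)).
(* For the universal composable triple, both bracketings reduce to a binary composite on each
   inclusion, so both are multiplications on [assoc_kite]. *)
have e : umg_mul m h1 = umg_mul m h2.
  apply: (@kite_mul_inj assoc_kite) => //; split=> /=.
  - rewrite (umg_mul_comp _ _ (comp_tail2 _ h1)) umg_mul_unit_r.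
      by rewrite -comp_assoc p11 comp_id_r.
    rewrite -!comp_assoc p11 p21 comp_id_r (comp_tail _ (pair2 _ _)).
    by rewrite umg_d comp_assoc.
  - rewrite (umg_mul_comp _ _ (comp_tail2 _ h1)) -[RHS]umg_mul_pb.
    apply: umg_mul_eq; rewrite -comp_assoc (p12, p22).
      by rewrite (comp_tail _ (umg_e2 m)) comp_id_l.
    by rewrite comp_id_r.
  - by rewrite d_umg_mul umg_d comp_assoc.
  - by rewrite c_umg_mul comp_assoc.
  - rewrite (umg_mul_comp _ _ (comp_tail2 _ h2)) -[RHS]umg_mul_pb.
    apply: umg_mul_eq; rewrite -comp_assoc (p11, p21).
      by rewrite comp_id_r.
    by rewrite (comp_tail _ (umg_e1 m)) comp_id_l.
  - rewrite (umg_mul_comp _ _ (comp_tail2 _ h2)) umg_mul_unit_l.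
      by rewrite -comp_assoc p22 comp_id_r.
    rewrite -!comp_assoc p12 p22 comp_id_r (comp_tail _ (pair1 _ _)).
    by rewrite umg_c comp_assoc.
  - by rewrite d_umg_mul comp_assoc.
  - by rewrite c_umg_mul umg_c comp_assoc.
have tE : sc_f assoc_cospan ∘ pair C2 x y xy
    = sc_g assoc_cospan ∘ pair C2 y z yz.
  by rewrite /= pair1 pair2.
have := f_equal (fun u => u ∘ pair P _ _ tE) e.
rewrite (umg_mul_comp _ _ (comp_tail2 _ h1)) (umg_mul_comp _ _ (comp_tail2 _ h2)).
move=> e'; apply: etrans (etrans e' _); apply: umg_mul_eq;
  by rewrite -comp_assoc ?pair1 ?pair2 /= ?pair1 ?pair2.
Qed.

End Associativity.

(** * The shift identity for pregroupoids *)

Section Inverses.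
Context (S : Span K) (MS : M S) (kS : KernelPairs S).
Context (p : PregroupoidStr lp kS).

(** Its pullback consists of x, v, y, z with <x,v> in D(d) and <v,y,z> in D(d,c); the inclusions are
    the cases v = y = z and x = v. *)
Definition shift_cospan : SplitCospan K :=
  @MkSplitCospan K (kp_d kS) (sp_D S) (kp_ob lp kS) (pb2 (kp_d kS))
    (kp_diag_d kS) (kp_dom lp kS) (kp_unit lp kS)
    (kp_diag_dK kS) (dom_triple _ _ _ _).

Lemma shift_kite_c :
  sp_c S ∘ 1_(sp_D S) ∘ kp_dom lp kS = sp_c S ∘ pg_p p.
Proof. by rewrite comp_id_r pg_c. Qed.

(* Both sides of the identity p(x,v,p(v,y,z)) = p(x,y,z) are multiplications on
   this kite. *)
Definition shift_kite : DiKiteOb K :=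
  @MkDiKite K shift_cospan S _ _ _ (kernel_kite_alpha_r kS)
    (pg_xyy p erefl) (kernel_kite_d kS) shift_kite_c.

(** By the unit laws both sides are x when v = y = z, and p(v,y,z) when x = v. *)
Lemma pg_shift Z (x v y z : hom Z (sp_D S))
    (xv : sp_d S ∘ x = sp_d S ∘ v) (vy : sp_d S ∘ v = sp_d S ∘ y)
    (xy : sp_d S ∘ x = sp_d S ∘ y) (yz : sp_c S ∘ y = sp_c S ∘ z)
    (vp : sp_c S ∘ v = sp_c S ∘ (pg_p p ∘ kp_triple lp kS vy yz)) :
  pg_p p ∘ kp_triple lp kS xv vp = pg_p p ∘ kp_triple lp kS xy yz.
Proof.
pose P := lp shift_cospan.
have vE : pb2 (kp_d kS) ∘ pb1 P = kp_dom lp kS ∘ pb2 P := pb_comm P.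
have p11 : pb1 P ∘ lp_e1 lp shift_cospan = 1_(kp_d kS) := pair1 _ _.
have p21 : pb2 P ∘ lp_e1 lp shift_cospan = kp_unit lp kS ∘ pb2 (kp_d kS) :=
  pair2 _ _.
have p12 : pb1 P ∘ lp_e2 lp shift_cospan = kp_diag_d kS ∘ kp_dom lp kS :=
  pair1 _ _.
have p22 : pb2 P ∘ lp_e2 lp shift_cospan = 1_(kp_ob lp kS) := pair2 _ _.
have xv' : sp_d S ∘ (pb1 (kp_d kS) ∘ pb1 P)
    = sp_d S ∘ (pb2 (kp_d kS) ∘ pb1 P).
  exact/comp_tail2/pb_comm.
have vp' : sp_c S ∘ (pb2 (kp_d kS) ∘ pb1 P) = sp_c S ∘ (pg_p p ∘ pb2 P).
  by rewrite vE (comp_tail2 _ (pg_c p)).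
have xy' : sp_d S ∘ (pb1 (kp_d kS) ∘ pb1 P)
    = sp_d S ∘ (kp_mid lp kS ∘ pb2 P).
  by rewrite xv' vE (comp_tail2 _ (kp_dom_mid lp kS)).
have yz' : sp_c S ∘ (kp_mid lp kS ∘ pb2 P)
    = sp_c S ∘ (kp_cod lp kS ∘ pb2 P).
  exact: (comp_tail2 _ (kp_mid_cod lp kS)).
have e : pg_p p ∘ kp_triple lp kS xv' vp' = pg_p p ∘ kp_triple lp kS xy' yz'.
  have pu : pg_p p ∘ kp_unit lp kS = 1_(sp_D S) := pg_xyy p erefl.
  have mu : kp_mid lp kS ∘ kp_unit lp kS = 1_(sp_D S) := mid_triple _ _ _ _.
  have cu : kp_cod lp kS ∘ kp_unit lp kS = 1_(sp_D S) := cod_triple _ _ _ _.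
  apply: (@kite_mul_inj shift_kite) => //; split=> /=.
  - rewrite -comp_assoc.
    rewrite (triple_comp _ _ _ _ (comp_tail2 _ xv') (comp_tail2 _ vp')).
    rewrite pg_unit_r -!comp_assoc p11 ?comp_id_r // p21.
    by rewrite (comp_tail _ pu) comp_id_l.
  - rewrite -comp_assoc.
    rewrite (triple_comp _ _ _ _ (comp_tail2 _ xv') (comp_tail2 _ vp')).
    rewrite pg_unit_l -!comp_assoc (p22, p12) ?comp_id_r //.
    by rewrite !comp_assoc kp_diag_dK pair1.
  - by rewrite pg_triple_d comp_assoc.
  - by rewrite pg_triple_c comp_assoc.
  - rewrite -comp_assoc.
    rewrite (triple_comp _ _ _ _ (comp_tail2 _ xy') (comp_tail2 _ yz')).
    rewrite pg_unit_r -!comp_assoc ?p11 ?comp_id_r // p21.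
    by rewrite !comp_assoc mu cu.
  - rewrite -comp_assoc -[RHS]comp_id_r; congr (_ ∘ _).
    apply: kp_uniq; rewrite comp_assoc ?dom_triple ?mid_triple ?cod_triple
      -comp_assoc ?p12 ?p22 //.
    by rewrite comp_assoc pair1 comp_id_l comp_id_r.
  - by rewrite pg_triple_d pg_d comp_assoc.
  - by rewrite pg_triple_c comp_assoc.
have tE : sc_f shift_cospan ∘ pair (kp_d kS) x v xv
    = sc_g shift_cospan ∘ kp_triple lp kS vy yz.
  by rewrite /= pair2 dom_triple.
have := f_equal (fun u => u ∘ pair P _ _ tE) e; rewrite -!comp_assoc.
rewrite (triple_comp _ _ _ _ (comp_tail2 _ xv') (comp_tail2 _ vp')).
rewrite (triple_comp _ _ _ _ (comp_tail2 _ xy') (comp_tail2 _ yz')).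
move=> e'; apply: etrans (etrans _ e') _; congr (_ ∘ _); apply: triple_eq;
  by rewrite -comp_assoc ?pair1 ?pair2 ?mid_triple ?cod_triple.
Qed.

End Inverses.

(** * Inverses from a pregroupoid structure on the span part *)

Section GroupoidInverses.
Context (X : RG K) (m : UMGStr lp X) (MX : RG_in M X).
Context (kX : KernelPairs (rg_span X)) (p : PregroupoidStr lp kX).

Lemma mul_triple_d Z (x : hom Z (rg_1 X)) :
  rg_d X ∘ x = rg_d X ∘ (rg_e X ∘ (rg_d X ∘ x)).
Proof. by rewrite [RHS](comp_tail _ (rg_de X)) comp_id_l. Qed.

Lemma mul_triple_c Z (x y : hom Z (rg_1 X)) :
  rg_d X ∘ x = rg_c X ∘ y ->
  rg_c X ∘ (rg_e X ∘ (rg_d X ∘ x)) = rg_c X ∘ y.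
Proof. by rewrite (comp_tail _ (rg_ce X)) comp_id_l. Qed.

(** The term p(x, e d x, y) is x if y = e d x, and y if x is an identity; so it defines a
    multiplication on the graph kite, which is unique. *)
Lemma umg_mul_triple Z (x y : hom Z (rg_1 X))
    (xy : rg_d X ∘ x = rg_c X ∘ y) :
  umg_mul m xy = pg_p p ∘ kp_triple (S := rg_span X) lp kX
    (mul_triple_d x) (mul_triple_c xy).
Proof.
pose C2 := rg_2 lp X; pose hd := mul_triple_d (pb1 C2).
pose hc := mul_triple_c (pb_comm C2).
have me1 := umg_e1 m; have me2 := umg_e2 m.
have e : umg_m m = pg_p p ∘ kp_triple (S := rg_span X) lp kX hd hc.
  apply: (@kite_mul_inj (graph_kite X)) => //.
    exact: (mk_is_kite_mul (umg_kite m)).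
  split=> /=.
  - rewrite -comp_assoc (triple_comp (S := rg_span X) _ _ _ _
      (comp_tail2 _ hd) (comp_tail2 _ hc)).
    by rewrite pg_unit_r ?pair1 // -!comp_assoc pair1 pair2 comp_id_r.
  - rewrite -comp_assoc (triple_comp (S := rg_span X) _ _ _ _
      (comp_tail2 _ hd) (comp_tail2 _ hc)).
    rewrite pg_unit_l ?pair2 // -!comp_assoc pair1 /=.
    by rewrite (comp_tail _ (rg_de X)) comp_id_l.
  - by rewrite (pg_triple_d (S := rg_span X)) comp_id_r.
  - by rewrite (pg_triple_c (S := rg_span X)) comp_id_r.
rewrite /umg_mul e -comp_assoc.
rewrite (triple_comp (S := rg_span X) _ _ _ _
  (comp_tail2 _ hd) (comp_tail2 _ hc)).
by congr (_ ∘ _); apply: triple_eq; rewrite -?comp_assoc ?pair1 ?pair2.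
Qed.

Lemma inv_triple_d : rg_d X ∘ (rg_e X ∘ rg_d X) = rg_d X ∘ 1_(rg_1 X).
Proof. by rewrite (comp_tail _ (rg_de X)) comp_id_l comp_id_r. Qed.

Lemma inv_triple_c : rg_c X ∘ 1_(rg_1 X) = rg_c X ∘ (rg_e X ∘ rg_c X).
Proof. by rewrite (comp_tail _ (rg_ce X)) comp_id_l comp_id_r. Qed.

Definition rg_inv : hom (rg_1 X) (rg_1 X) :=
  pg_p p ∘ kp_triple (S := rg_span X) lp kX inv_triple_d inv_triple_c.

Lemma rg_inv_d : rg_d X ∘ rg_inv = rg_c X.
Proof.
by rewrite /rg_inv (pg_triple_d p) /= (comp_tail _ (rg_de X)) comp_id_l.
Qed.

Lemma rg_inv_c : rg_c X ∘ rg_inv = rg_d X.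
Proof.
by rewrite /rg_inv (pg_triple_c p) /= (comp_tail _ (rg_ce X)) comp_id_l.
Qed.

(** The product is p(x, e d x, p(e d x, x, e c x)), which [pg_shift] contracts to p(x, x, e c x) = e
    c x. *)
Lemma umg_mul_inv : umg_mul m (umg_inv_r rg_inv_c) = rg_e X ∘ rg_c X.
Proof.
rewrite umg_mul_triple.
have vp : rg_c X ∘ (rg_e X ∘ rg_d X) = rg_c X ∘ rg_inv.
  by rewrite rg_inv_c (comp_tail _ (rg_ce X)) comp_id_l.
have e := pg_shift MX (esym inv_triple_d : sp_d (rg_span X) ∘ _ = _)
  (erefl (sp_d (rg_span X) ∘ 1_(rg_1 X)))
  (vp : sp_c (rg_span X) ∘ _ = sp_c (rg_span X) ∘ _).
rewrite pg_yyz in e; apply: etrans _ e; congr (_ ∘ _).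
by apply: triple_eq; rewrite ?comp_id_r.
Qed.

(* A right inverse of every arrow is two-sided: [i ∘ i] is a right inverse of
   [i], so by associativity it is the identity. *)
Lemma umg_inverses : umg_has_inverses m.
Proof.
exists rg_inv, rg_inv_d, rg_inv_c; split; first exact: umg_mul_inv.
have ij : rg_d X ∘ rg_inv = rg_c X ∘ (rg_inv ∘ rg_inv).
  by rewrite comp_assoc rg_inv_c.
have ijE : umg_mul m ij = rg_e X ∘ rg_d X.
  have h : rg_d X ∘ (1_(rg_1 X) ∘ rg_inv) = rg_c X ∘ (rg_inv ∘ rg_inv).
    by rewrite comp_id_l.
  have e := f_equal (fun u => u ∘ rg_inv) umg_mul_inv.
  rewrite (umg_mul_comp _ _ h) -comp_assoc rg_inv_c in e.
  by rewrite -e; apply: umg_mul_eq; rewrite ?comp_id_l.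
have jE : rg_inv ∘ rg_inv = 1_(rg_1 X).
  have := umg_assoc m MX (umg_inv_r rg_inv_c) ij.
  rewrite umg_mul_unit_l => [->|].
    by rewrite umg_mul_unit_r // comp_id_r.
  by rewrite umg_mul_inv (comp_assoc (rg_c X)) rg_inv_c rg_inv_d.
by rewrite -ijE; apply: umg_mul_eq.
Qed.

End GroupoidInverses.

(** * Isomorphisms over reflexive graphs *)

Lemma umg_of (X : RG K) : RG_in M X -> UMGStr lp X.
Proof. by move=> MX; apply/kite_umg/mkite_of. Qed.

Definition umg_ob (X : RGM M) : UMG lp :=
  existT _ (sval X) (umg_of (svalP X)).

Lemma umg_ob_eq (A : UMG lp) (MA : RG_in M (projT1 A)) :
  umg_ob (exist _ (projT1 A) MA) = A.
Proof.
by case: A MA => X m MX; congr existT; apply: umg_str_eq.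
Qed.

Definition umg_lift (A B : UMG lp) (MB : RG_in M (projT1 B))
    (u : hom (projT1 A) (projT1 B)) : hom A B :=
  exist _ u (umg_natural (projT2 A) (projT2 B) u MB).

Lemma diagonals_UMG_iso : is_isomorphism (UMG_to_RG lp M).
Proof.
pose g (X : RGM M) : UMGM lp M := exist _ (umg_ob X) (svalP X).
pose lift (A B : UMGM lp M) (u : hom (UMG_to_RG lp M A) (UMG_to_RG lp M B)) :
  hom A B := umg_lift (svalP B) u.
apply: (iso_criterion (g := g) (lift := lift)) => //.
- by move=> X; apply: sub_eq.
- by move=> A; apply: sub_eq; apply: umg_ob_eq.
- by move=> A B u v e; apply: sub_eq.
Qed.

Lemma diagonals_Cat_iso : is_isomorphism (Cat_to_RG lp M).
Proof.
pose g (X : RGM M) : CatM lp M :=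
  exist _ (exist _ (umg_ob X) (umg_assoc _ (svalP X)) : Cat lp) (svalP X).
pose lift (A B : CatM lp M) (u : hom (Cat_to_RG lp M A) (Cat_to_RG lp M B)) :
  hom A B := umg_lift (svalP B) u.
apply: (iso_criterion (g := g) (lift := lift)) => //.
- by move=> X; apply: sub_eq.
- by move=> A; apply: sub_eq; apply: sub_eq; apply: umg_ob_eq.
- by move=> A B u v e; apply: sub_eq.
Qed.

Lemma diagonals_Grpd_iso : is_isomorphism (Grpd_to_RG lp M).
Proof.
(* The pregroupoid structure behind the inverses is the multiplication on the kernel kite of the
   span part. *)
have inv (X : RGM M) : umg_has_inverses (projT2 (umg_ob X)).
  apply: (umg_inverses _ (svalP X)).
  exact: kite_pregroupoid (@mkite_of (kernel_kite (kp (svalP X))) (svalP X)).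
pose g (X : RGM M) : GrpdM lp M :=
  exist _ (exist _ (exist _ (umg_ob X) (umg_assoc _ (svalP X)) : Cat lp) (inv X)
    : Grpd lp) (svalP X).
pose lift (A B : GrpdM lp M) (u : hom (Grpd_to_RG lp M A) (Grpd_to_RG lp M B)) :
  hom A B := umg_lift (svalP B) u.
apply: (iso_criterion (g := g) (lift := lift)) => //.
- by move=> X; apply: sub_eq.
- by move=> A; do 3 apply: sub_eq; apply: umg_ob_eq.
- by move=> A B u v e; apply: sub_eq.
Qed.

End Main.

Theorem theorem2 (K : Category) (lp : LocalProducts K) (M : Span K -> Prop)
    (kp : forall S : Span K, M S -> KernelPairs S)
    (M_kernel_pairs : closed_under_kernel_pairs lp kp)
    (M_local_products : contains_local_products lp M) :
  [<-> is_isomorphism (Grpd_to_RG lp M);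
       has_section (Grpd_to_RG lp M);
       is_isomorphism (Cat_to_RG lp M);
       has_section (Cat_to_RG lp M);
       is_isomorphism (UMG_to_RG lp M);
       has_section (UMG_to_RG lp M);
       is_isomorphism (PreGrpd_to_Span lp kp);
       has_section (PreGrpd_to_Span lp kp);
       is_isomorphism (MKite_to_DiKite lp M);
       has_section (MKite_to_DiKite lp M);
       forall (A C E D D0 D1 : K)
         (p1 : hom E A) (e1 : hom A E) (p2 : hom E C) (e2 : hom C E)
         (alpha : hom A D) (beta : hom E D) (gamma : hom C D)
         (d : hom D D0) (c : hom D D1),
         jointly_monic p1 p2 ->
         M (MkSpan d c) -> M (MkSpan p1 p2) ->
         p1 ∘ e1 = 1_A -> p2 ∘ e2 = 1_C ->
         (e1 ∘ p1) ∘ (e2 ∘ p2) = (e2 ∘ p2) ∘ (e1 ∘ p1) ->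
         alpha ∘ (p1 ∘ e2 ∘ p2) = beta -> beta = gamma ∘ (p2 ∘ e1 ∘ p1) ->
         d ∘ alpha ∘ p1 = d ∘ alpha ∘ (p1 ∘ e2 ∘ p2) ->
         c ∘ gamma ∘ p2 = c ∘ gamma ∘ (p2 ∘ e1 ∘ p1) ->
         exists! m : hom E D,
           [/\ m ∘ e1 = alpha, m ∘ e2 = gamma,
               d ∘ m = d ∘ gamma ∘ p2 & c ∘ m = c ∘ alpha ∘ p1] ].
Proof.
have umg := natural_umg_pregroupoids M_kernel_pairs.
have diag := natural_pregroupoids_diagonals M_kernel_pairs.
(* A single cycle: isomorphisms give sections, each section gives (11) and thence the next
   isomorphism, the last section gives (11) itself, and (11) returns to the first condition. *)
tfae.
- exact: iso_has_section.
- move=> /section_Grpd_natural /umg /diag.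
  exact: diagonals_Cat_iso.
- exact: iso_has_section.
- move=> /section_Cat_natural /umg /diag.
  exact: diagonals_UMG_iso.
- exact: iso_has_section.
- move=> /section_UMG_natural /umg /diag.
  exact: diagonals_PreGrpd_iso.
- exact: iso_has_section.
- move=> /section_PreGrpd_natural /diag.
  exact: diagonals_MKite_iso.
- exact: iso_has_section.
- by move=> /(section_MKite_natural kp) /diag.
- exact: diagonals_Grpd_iso.
Qed.
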